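(* Let $n,N,M$ be positive integers with $(n,M)\neq(1,1)$. Then the generating function of the partial multiple $L$-values $S^{(N,M)}_k(n)$ is given by $$\sum_{k=0}^\infty S^{(N,M)}_k(n)\,x^{nk} =\prod_{k=1}^M \frac{\prod_{j=0}^{2n-1}\Gamma\left(\frac1M\left(k-\frac1N\,\omega_{2n}^{j}\,\omega_{Mn}^{kN}\,x\right)\right)} {\Gamma\left(\frac kM\right)^{n}\prod_{j=0}^{n-1}\Gamma\left(\frac1M\left(k-\omega_{2n}^{2j-1}\,\omega_{Mn}^{k}\,x\right)\right)},$$ as an identity of power series in $x$ around $x=0$ (the right-hand side being identified with its Taylor expansion at $0$).
   Context: For a positive integer $m$, $\omega_m$ denotes a primitive $m$-th root of unity; these are chosen compatibly, so that $\omega_{Mn}^n=\omega_M$ (e.g. $\omega_m=e^{2\pi i/m}$). $\Gamma$ is the gamma function. For positive integers $i,j$ put $\varepsilon^{(N)}_{ij}=0$ if $i=j$ and $N\nmid i$, and $\varepsilon^{(N)}_{ij}=1$ otherwise; put $\varepsilon^{(N)}_{i_1i_2\dots i_k}=\prod_{j=1}^{k-1}\varepsilon^{(N)}_{i_ji_{j+1}}$ (equal to $1$ for $k=1$). For $k\ge1$, $$S^{(N,M)}_k(n)=\sum_{1\le i_1\le i_2\le\dots\le i_k}\varepsilon^{(N)}_{i_1i_2\dots i_k}\frac{\omega_M^{i_1+i_2+\dots+i_k}}{i_1^{n}i_2^{n}\cdots i_k^{n}},$$ and $S^{(N,M)}_0(n)=1$. When $n=1$ (so $M\ge2$) the conditionally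 convergent sum is understood as the limit as $X\to\infty$ of the finite sums restricted to $i_k\le X$. *)

(* Defs.v *)
From HB Require Import structures.
From mathcomp Require Import all_boot all_order all_algebra.
From mathcomp Require Import complex.
From mathcomp Require Import all_classical all_reals all_analysis.

Set Implicit Arguments.
Unset Strict Implicit.
Unset Printing Implicit Defensive.

Import Order.TTheory GRing.Theory Num.Theory.
Import numFieldNormedType.Exports.

Local Open Scope classical_set_scope.
Local Open Scope ring_scope.

(* The complex numbers over R, named as a [numClosedFieldType] so that the
   norm topology of MathComp-Analysis is inferred on them: it is not inferred
   on the bare type [R[i]]. *)
Definition cplx (R : realType) : numClosedFieldType := R[i].

Section Gamma.
Variable R : realType.
Local Notation C := (cplx R).

Definition cexp (z : C) : C :=
  (expR (complex.Re z))%:C%C *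
  (cos (complex.Im z) +i* sin (complex.Im z))%C.

(* t ^ z for t > 0, principal value *)
Definition cpow (t : R) (z : C) : C := cexp (z * (ln t)%:C%C).

Definition cintegral (D : set R) (f : R -> C) : C :=
  (Rintegral lebesgue_measure D (fun t => complex.Re (f t)) +i*
   Rintegral lebesgue_measure D (fun t => complex.Im (f t)))%C.

(* Euler's integral of the second kind; meaningful for Re z > 0 *)
Definition gamma_integral (z : C) : C :=
  cintegral `]0, +oo[ (fun t => (expR (- t))%:C%C * cpow t (z - 1)).

(* the least m with Re z + m > 0 *)
Definition gamma_shift (z : C) : nat :=
  if 0 < complex.Re z then 0%N else (Num.truncn (- complex.Re z)).+1.

(* Analytic continuation of Euler's integral by
   Gamma z = Gamma (z + m) / (z (z + 1) ... (z + m - 1)), for any m with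
   Re z + m > 0; the value at the poles 0, -1, -2, ... is irrelevant. *)
Definition Gamma (z : C) : C :=
  gamma_integral (z + (gamma_shift z)%:R) /
  \prod_(i < gamma_shift z) (z + i%:R).

End Gamma.

Section PartialMultipleL.
Variable R : realType.
Local Notation C := (cplx R).

Definition compatible_roots (w : nat -> C) : Prop :=
  (forall m : nat, (0 < m)%N -> m.-primitive_root (w m)) /\
  (forall a b : nat, (0 < a)%N -> (0 < b)%N -> w (a * b)%N ^+ b = w a).

Definition eps (N i j : nat) : nat :=
  if (i == j) && ~~ (N %| i)%N then 0%N else 1%N.

Definition eps_seq (N : nat) (s : seq nat) : nat :=
  (\prod_(j < (size s).-1) eps N (nth 0%N s j) (nth 0%N s j.+1))%N.

(* The finite sum restricted to 1 <= i_1 <= ... <= i_k <= X; the tuple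
   (i_1, ..., i_k) has entries in {0, ..., X}, and [path leq 1] says that
   1, i_1, ..., i_k is weakly increasing. *)
Definition partialS (w : nat -> C) (N M n k X : nat) : C :=
  \sum_(t : k.-tuple 'I_X.+1 | path leq 1%N [seq val i | i <- t])
    let s := [seq val i | i <- t] in
    (eps_seq N s)%:R * (w M ^+ (\sum_(i <- s) i)%N / \prod_(i <- s) i%:R ^+ n).

Definition multipleS (w : nat -> C) (N M n k : nat) : C :=
  if k is 0%N then 1 else lim (partialS w N M n k X @[X --> \oo]).

Definition gammaRHS (w : nat -> C) (N M n : nat) (x : C) : C :=
  \prod_(1 <= k < M.+1)
    ((\prod_(0 <= j < 2 * n)
        Gamma (M%:R^-1 *
               (k%:R - N%:R^-1 * w (2 * n)%N ^+ j * w (M * n)%N ^+ (k * N) * x)))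
     / (Gamma (k%:R / M%:R) ^+ n *
        \prod_(0 <= j < n)
          Gamma (M%:R^-1 *
                 (k%:R - w (2 * n)%N ^ (2 * j%:Z - 1) * w (M * n)%N ^+ k * x)))).

End PartialMultipleL.

(* Main.v *)
Require Import Defs.
From HB Require Import structures.
From mathcomp Require Import all_boot all_order all_algebra.
From mathcomp Require Import complex.
From mathcomp Require Import all_classical all_reals all_analysis.
From mathcomp Require Import measurable_realfun.
From mathcomp Require Import ring lra zify.

Set Implicit Arguments.
Unset Strict Implicit.
Unset Printing Implicit Defensive.

Import Order.TTheory GRing.Theory Num.Theory.
Import numFieldNormedType.Exports.

Local Open Scope classical_set_scope.
Local Open Scope ring_scope.

(** Put a_i = w_M^i / i^n and t = x^n.  Restricting all indices to [1, X]
    turns the generating function into a finite product: an index i that N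
    does not divide is used at most once and contributes 1 + a_i t, an index
    divisible by N may be repeated and contributes 1/(1 - a_i t).  Hence
      F_X(t) = prod_(i <= X) (1 + a_i t)
               / prod_(N l <= X) (1 - (a_(N l) t)^2)
    ([eps_sumS], [cvg_eps_sum_gen], [prod_local_factor]).

    Since w_(Mn)^n = w_M, the factor 1 + a_i t is 1 + y^n and the factor
    1 - (a_(N l) t)^2 is 1 - y^(2n), with y a root of unity times x / i, resp.
    x / (N l).  Both split over the 2n-th roots of unity, and sorting i and l
    by residue mod M presents F_X, for X = M N (p + 1), as a quotient of
    products of (z + q) / (k/M + q) over q, where the z are the arguments of
    Gamma in the statement ([num_factor], [den_factor]).  Such products
    converge to quotients of Gamma values by Gauss's formula
      Gamma z = lim_p p^z p! / (z (z + 1) ... (z + p)),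
    because the z and the k/M have equal sums, which kills the powers p^z
    ([cvg_gamma_prod]); equality of the sums uses (n, M) <> (1, 1).

    Gauss's formula ([cvg_gauss]) comes from dominated convergence of
    int_0^p (1 - t/p)^p t^(z-1) dt to Euler's integral; the approximating
    integrals are computed by induction on the exponent of (1 - t/p).  To
    divide by Gamma one also needs Gamma z <> 0, here for 0 < Re z < 2
    ([Gamma_neq0]): the product of the p-th approximations at z and 2 - z is
    bounded away from 0.

    It remains to exchange the limit in X with the sum over k.  Taking
    logarithmic derivatives of F_X gives Newton's identities
      k S_k = sum_(1 <= j <= k) c_j S_(k-j),
    with c_j the sum over i <= X of +a_i^j or -(-a_i)^j ([newton_eps_sum]).
    The c_j converge as X grows (absolutely when n j >= 2, by summation by
    parts when n = j = 1, where again M > 1) and are bounded uniformly in X and j.  Newton's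
    identities then give both the convergence of the coefficients S_k and a
    uniform bound |S_k| <= B^k, so that the tails of the generating functions
    are uniformly small for |x| < 1/(2B) ([newton_cvg], [newton_bound],
    [cvg_exchange]). *)

(** * Real and imaginary parts of t ^ z *)

Section PowerFunctions.
Variable R : realType.
Local Notation C := (cplx R).
Local Notation mu := (@lebesgue_measure R).
Implicit Types (s tau t a b x : R) (z : C).

Lemma Re_cpow t z :
  complex.Re (cpow t z) =
    expR (complex.Re z * ln t) * cos (complex.Im z * ln t).
Proof.
by case: z => a b; rewrite /cpow /cexp /= !mulr0 subr0 add0r mul0r subr0.
Qed.

Lemma Im_cpow t z :
  complex.Im (cpow t z) =
    expR (complex.Re z * ln t) * sin (complex.Im z * ln t).
Proof.
by case: z => a b; rewrite /cpow /cexp /= !mulr0 subr0 add0r mul0r addr0.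
Qed.

Lemma expRlnB1 s t : 0 < t -> expR ((s - 1) * ln t) = expR (s * ln t) * t^-1.
Proof. by move=> t0; rewrite mulrBl mul1r expRB lnK. Qed.

Lemma is_derive_expRln s t : 0 < t ->
  is_derive t 1 (fun t => expR (s * ln t)) (s * expR ((s - 1) * ln t)).
Proof.
move=> t0; have dl := is_derive1_ln t0.
have d1 : is_derive t 1 (fun t => s * ln t) (s * t^-1).
  exact: (is_deriveZ s (V := R) (f := @ln R)).
apply: (is_derive_eq (is_derive1_comp (f := expR) (is_derive_expR _) d1)).
by rewrite expRlnB1//; ring.
Qed.

Lemma is_derive_coslin tau t : 0 < t ->
  is_derive t 1 (fun t => cos (tau * ln t)) (- tau * t^-1 * sin (tau * ln t)).
Proof.
move=> t0; have dl := is_derive1_ln t0.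
have d1 : is_derive t 1 (fun t => tau * ln t) (tau * t^-1).
  exact: (is_deriveZ tau (V := R) (f := @ln R)).
apply: (is_derive_eq (is_derive1_comp (f := cos) (is_derive_cos _) d1)).
by ring.
Qed.

Lemma is_derive_sinlin tau t : 0 < t ->
  is_derive t 1 (fun t => sin (tau * ln t)) (tau * t^-1 * cos (tau * ln t)).
Proof.
move=> t0; have dl := is_derive1_ln t0.
have d1 : is_derive t 1 (fun t => tau * ln t) (tau * t^-1).
  exact: (is_deriveZ tau (V := R) (f := @ln R)).
apply: (is_derive_eq (is_derive1_comp (f := sin) (is_derive_sin _) d1)).
by ring.
Qed.

Lemma is_derive_Re_cpow z t : 0 < t ->
  is_derive t 1 (fun t => complex.Re (cpow t z))
    (complex.Re z * complex.Re (cpow t (z - 1)) -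
     complex.Im z * complex.Im (cpow t (z - 1))).
Proof.
move=> t0.
have -> : (fun t => complex.Re (cpow t z)) =
   (fun t => expR (complex.Re z * ln t)) * (fun t => cos (complex.Im z * ln t)).
  by apply/funext => u; rewrite Re_cpow.
apply: (is_derive_eq (is_deriveM (is_derive_expRln (complex.Re z) t0)
  (is_derive_coslin (complex.Im z) t0))).
rewrite Re_cpow Im_cpow /GRing.scale /=.
case: z => a c /=; rewrite !oppr0 !addr0 expRlnB1//; ring.
Qed.

Lemma is_derive_Im_cpow z t : 0 < t ->
  is_derive t 1 (fun t => complex.Im (cpow t z))
    (complex.Re z * complex.Im (cpow t (z - 1)) +
     complex.Im z * complex.Re (cpow t (z - 1))).
Proof.
move=> t0.
have -> : (fun t => complex.Im (cpow t z)) =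
   (fun t => expR (complex.Re z * ln t)) * (fun t => sin (complex.Im z * ln t)).
  by apply/funext => u; rewrite Im_cpow.
apply: (is_derive_eq (is_deriveM (is_derive_expRln (complex.Re z) t0)
  (is_derive_sinlin (complex.Im z) t0))).
rewrite Re_cpow Im_cpow /GRing.scale /=.
case: z => a c /=; rewrite !oppr0 !addr0 expRlnB1//; ring.
Qed.

Lemma expRln_cvg0 s : 0 < s -> expR (s * ln t) @[t --> 0^'+] --> 0.
Proof.
move=> s0; have := powR_cvg0 s0; apply: cvg_trans; apply: near_eq_cvg.
near=> t; rewrite /powR gt_eqF//; near: t; exact: nbhs_right_gt.
Unshelve. all: by end_near. Qed.

Lemma is_derive_continuous (F : R -> R) x (df : R) :
  is_derive x 1 F df -> {for x, continuous F}.
Proof.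
by move=> d; apply: differentiable_continuous; apply/derivable1_diffP;
  exact: ex_derive.
Qed.

Lemma continuous_expRln s t : 0 < t ->
  {for t, continuous (fun t => expR (s * ln t))}.
Proof. by move=> t0; exact: is_derive_continuous (is_derive_expRln s t0). Qed.

Lemma integral_is_derive (F f : R -> R) a b : a < b ->
  (forall x, a <= x <= b -> is_derive x 1 F (f x)) ->
  (forall x, a <= x <= b -> {for x, continuous f}) ->
  (\int[mu]_(x in `[a, b]) (f x)%:E = (F b - F a)%:E)%E.
Proof.
move=> ab dF cf.
have cF x : a <= x <= b -> {for x, continuous F}.
  by move=> /dF; exact: is_derive_continuous.
rewrite (@continuous_FTC2 _ _ F _ _ ab)//.
- by apply: continuous_in_subspaceT => x; rewrite inE/= in_itv/=; exact: cf.
- split.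
  + move=> x; rewrite in_itv/= => /andP[ax xb]; have := dF x.
    by rewrite !ltW// => /(_ isT) d; exact: ex_derive.
  + by apply: cvg_at_right_filter; apply: cF; rewrite lexx ltW.
  + by apply: cvg_at_left_filter; apply: cF; rewrite lexx ltW.
- move=> x; rewrite in_itv/= => /andP[ax xb]; have := dF x.
  by rewrite !ltW// derive1E => /(_ isT) d; exact: derive_val.
Qed.

Lemma measurable_expRln s (D : set R) :
  measurable_fun D (fun t : R => expR (s * ln t)).
Proof.
apply: measurable_funTS; apply: measurableT_comp => //.
by apply: measurable_funM => //; exact: measurable_ln.
Qed.

(** The singularity of t ^ (s - 1) at 0 is integrable for s > 0: the integrals
    over [1/(m + 1), b] are bounded by b ^ s / s. *)
Lemma integrable_expRln s b : 0 < s ->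
  mu.-integrable `]0, b] (EFin \o (fun t => expR ((s - 1) * ln t))).
Proof.
move=> s0.
have mf D : measurable_fun D (EFin \o (fun t : R => expR ((s - 1) * ln t))).
  by apply/measurable_EFinP; exact: measurable_expRln.
have [b0|b0] := leP b 0.
  by rewrite set_itv_ge ?bnd_simp -?leNgt//; exact: integrable_set0.
apply/integrableP; split; first exact: mf.
under eq_integral do rewrite /= ger0_norm ?expR_ge0//.
have U : `]0, b]%classic = \bigcup_n `[n.+1%:R^-1, b]%classic :> set R.
  apply/seteqP; split => x /=; rewrite in_itv/=.
    move=> /andP[x0 xb]; exists (Num.truncn x^-1) => //=;
      rewrite in_itv/= xb andbT.
    rewrite invf_ple ?posrE//; apply: ltW; exact: truncnS_gt.
  by move=> [n _ /=]; rewrite in_itv/= => /andP[nx ->];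
    rewrite andbT (lt_le_trans _ nx).
rewrite U.
have mono n m x : (n <= m)%N -> `[n.+1%:R^-1, b]%classic x ->
  `[m.+1%:R^-1 : R, b]%classic x.
  move=> nm /=; rewrite !in_itv/= => /andP[nx ->]; rewrite andbT.
  by apply: le_trans nx; rewrite lef_pV2 ?posrE ?ltr0n// ler_nat.
have := @ge0_nondecreasing_set_cvg_integral _ (measurableTypeR R) R
  (fun n => `[n.+1%:R^-1, b]%classic)
  (EFin \o (fun t => expR ((s - 1) * ln t))) mu.
move=> /(_ _ _ _ _)/cvg_lim <- //; last 3 first.
- by move=> n m nm; rewrite subsetEset => x; exact: mono.
- by move=> n; exact: mf.
- by move=> i x _ /=; rewrite lee_fin; exact: expR_ge0.
apply: (@le_lt_trans _ _ (expR (s * ln b) / s)%:E); last exact: ltry.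
apply: lime_le.
  apply: ereal_nondecreasing_is_cvgn => n m nm;
    apply: ge0_subset_integral => //.
  - exact: mf.
  - by move=> x _ /=; rewrite lee_fin; exact: expR_ge0.
  - by move=> x; exact: mono.
near=> n.
have n0 : 0 < n.+1%:R^-1 :> R by [].
have nb : n.+1%:R^-1 < b.
  near: n; exact: (cvgr_lt 0 (@cvg_harmonic R)).
have ct x : n.+1%:R^-1 <= x ->
  {for x, continuous (fun t : R => expR ((s - 1) * ln t))}.
  by move=> nx; apply: continuous_expRln; exact: lt_le_trans nx.
have dF (x : R) : n.+1%:R^-1 <= x ->
  is_derive x 1 (fun t : R => expR (s * ln t) / s) (expR ((s - 1) * ln x)).
  move=> nx; have x0 : 0 < x by exact: lt_le_trans nx.
  have -> : (fun t : R => expR (s * ln t) / s) =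
      s^-1 *: (fun t => expR (s * ln t)).
    by apply/funext => t; rewrite /= /GRing.scale /= mulrC.
  have d := is_derive_expRln s x0.
  apply: is_derive_eq.
  by rewrite /GRing.scale /= mulrA mulVf ?mul1r// gt_eqF.
rewrite [leLHS](integral_is_derive (F := fun t => expR (s * ln t) / s)
  (f := fun t => expR ((s - 1) * ln t)) nb); last 2 first.
- by move=> x /andP[/dF].
- by move=> x /andP[/ct].
by rewrite lee_fin gerBl divr_ge0 ?expR_ge0// ltW.
Unshelve. all: by end_near. Qed.

Lemma continuous_Re_cpow z t : 0 < t ->
  {for t, continuous (fun t => complex.Re (cpow t z))}.
Proof. by move=> t0; exact: is_derive_continuous (is_derive_Re_cpow z t0). Qed.

Lemma continuous_Im_cpow z t : 0 < t ->
  {for t, continuous (fun t => complex.Im (cpow t z))}.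
Proof. by move=> t0; exact: is_derive_continuous (is_derive_Im_cpow z t0). Qed.

Lemma measurable_Re_cpow z (D : set R) :
  measurable_fun D (fun t => complex.Re (cpow t z)).
Proof.
under eq_fun do rewrite Re_cpow.
apply: measurable_funM; first exact: measurable_expRln.
apply: measurable_funTS; apply: measurableT_comp => //;
  first exact: (continuous_measurable_fun (@continuous_cos R)).
by apply: measurable_funM => //; exact: measurable_ln.
Qed.

Lemma measurable_Im_cpow z (D : set R) :
  measurable_fun D (fun t => complex.Im (cpow t z)).
Proof.
under eq_fun do rewrite Im_cpow.
apply: measurable_funM; first exact: measurable_expRln.
apply: measurable_funTS; apply: measurableT_comp => //;
  first exact: (continuous_measurable_fun (@continuous_sin R)).
by apply: measurable_funM => //; exact: measurable_ln.
Qed.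

Lemma le_Re_cpow t z : `|complex.Re (cpow t z)| <= expR (complex.Re z * ln t).
Proof.
rewrite Re_cpow normrM ger0_norm ?expR_ge0// ler_piMr ?expR_ge0//.
by rewrite ler_norml cos_geN1 cos_le1.
Qed.

Lemma le_Im_cpow t z : `|complex.Im (cpow t z)| <= expR (complex.Re z * ln t).
Proof.
rewrite Im_cpow normrM ger0_norm ?expR_ge0// ler_piMr ?expR_ge0//.
by rewrite ler_norml sin_geN1 sin_le1.
Qed.

(** The fundamental theorem of calculus on ]0, b] for a primitive F that is
    O(x ^ s), hence tends to 0, at the possibly singular endpoint 0. *)
Lemma Rintegral_FTC_at0 (F f : R -> R) s b : 0 < s -> 0 < b ->
  (forall x, 0 < x -> is_derive x 1 F (f x)) ->
  (forall x, 0 < x -> {for x, continuous f}) ->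
  (forall x, 0 < x -> `|F x| <= expR (s * ln x)) ->
  mu.-integrable `]0, b] (EFin \o f) ->
  \int[mu]_(x in `]0, b]) f x = F b.
Proof.
move=> s0 b0 dF cf leF intf.
have mf : measurable_fun `]0, b] f.
  by case/integrableP: intf => /measurable_EFinP.
have intf' : mu.-integrable `[0, b] (EFin \o f).
  apply/integrableP; split.
    by apply/measurable_EFinP/measurable_fun_itv_obnd_cbndP.
  rewrite -integral_itv_obnd_cbnd; first by case/integrableP: intf.
  by apply: measurableT_comp => //; exact/measurable_EFinP.
have := parameterized_integral_cvg_left b0 intf'.
rewrite /parameterized_integral => cvi.
have F0 : F x @[x --> 0^'+] --> 0.
  apply/norm_cvg0P.
  apply: (@squeeze_cvgr _ _ _ _ (fun=> 0) (fun x => expR (s * ln x)));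
    last 2 first.
  - exact: cvg_cst.
  - exact: expRln_cvg0.
  near=> x; rewrite normr_ge0 leF//.
(* this expression in x is constant, equal to the integral over ]0, b] *)
have cvgFb : F b - F x + \int[mu]_(t in `[0, x]) f t @[x --> 0^'+] --> F b.
  rewrite -[X in _ --> X]subr0 -[X in _ --> X]addr0; apply: cvgD.
    by apply: cvgB => //; exact: cvg_cst.
  by apply: cvg_at_right_filter => //; rewrite /= set_itv1 Rintegral_set1.
apply/esym/(cvg_unique _ cvgFb) => //.
apply: cvg_near_cst; near=> x.
have x0 : 0 < x by [].
have xb : x < b by [].
rewrite (Rintegral_itv_obnd_cbnd intf).
rewrite -(subrK (\int[mu]_(t in `[0, x]) f t) (\int[mu]_(t in `[0, b]) f t)).
rewrite (@Rintegral_itvB _ f (BLeft 0) (BRight b) x)// ?bnd_simp ?ltW//.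
rewrite Rintegral_itv_obnd_cbnd; last first.
  by apply: integrableS intf => //; apply: subset_itvr; rewrite bnd_simp ltW.
have E : (\int[mu]_(t in `[x, b]) (f t)%:E = (F b - F x)%:E)%E.
  apply: integral_is_derive => // y /andP[xy _].
    by apply: dF; exact: lt_le_trans xy.
  by apply: cf; exact: lt_le_trans xy.
by rewrite /Rintegral E.
Unshelve. all: by end_near. Qed.

Lemma integrable_Re_cpow z b : 0 < complex.Re z ->
  mu.-integrable `]0, b] (EFin \o (fun t => complex.Re (cpow t (z - 1)))).
Proof.
move=> z0; apply: le_integrable (integrable_expRln b z0) => //.
  by apply/measurable_EFinP; exact: measurable_Re_cpow.
move=> x _ /=; rewrite lee_fin (ger0_norm (expR_ge0 _)).
by apply: le_trans (le_Re_cpow _ _) _; case: z {z0} => u v /=.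
Qed.

Lemma integrable_Im_cpow z b : 0 < complex.Re z ->
  mu.-integrable `]0, b] (EFin \o (fun t => complex.Im (cpow t (z - 1)))).
Proof.
move=> z0; apply: le_integrable (integrable_expRln b z0) => //.
  by apply/measurable_EFinP; exact: measurable_Im_cpow.
move=> x _ /=; rewrite lee_fin (ger0_norm (expR_ge0 _)).
by apply: le_trans (le_Im_cpow _ _) _; case: z {z0} => u v /=.
Qed.

End PowerFunctions.

(** * Euler's integral as a limit of integrals over ]0, p] *)

Section ExpLimit.
Variable R : realType.
Local Notation mu := (@lebesgue_measure R).
Implicit Types (s t a b : R) (p m : nat).

Lemma ler_subX a b p : 0 <= b -> b <= a -> a <= 1 ->
  a ^+ p - b ^+ p <= p%:R * (a - b).
Proof.
move=> b0 ba a1; have a0 := le_trans b0 ba.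
elim: p => [|p ih]; first by rewrite !expr0 subrr mul0r.
have -> : a ^+ p.+1 - b ^+ p.+1 = a * (a ^+ p - b ^+ p) + b ^+ p * (a - b).
  by rewrite !exprS; ring.
rewrite -[p.+1]addn1 natrD mulrDl mul1r lerD//.
  apply: le_trans ih; rewrite ler_piMl// subr_ge0 lerXn2r//.
by rewrite ler_piMl ?subr_ge0// exprn_ile1// (le_trans ba).
Qed.

Lemma exp_sub_bounds t p : 0 <= t <= p%:R ->
  (1 - t / p%:R) ^+ p <= expR (- t) <= (1 - t / p%:R) ^+ p + t ^+ 2 / p%:R.
Proof.
case: p => [|p] /andP[t0 tp].
  have -> : t = 0 by apply/eqP; rewrite eq_le t0 andbT.
  by rewrite !expr0 oppr0 expR0 expr0n/= mul0r addr0 !lexx.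
set s := t / _; have p0 : 0 < p.+1%:R :> R by [].
have s0 : 0 <= s by rewrite divr_ge0.
have s1 : s <= 1 by rewrite ler_pdivrMr// mul1r.
have e1 := expR_ge1Dx (- s).
have E : expR (- t) = expR (- s) ^+ p.+1.
  by rewrite -expRM_natl mulrN mulrC divfK// gt_eqF.
have b0 : 0 <= 1 - s by rewrite subr_ge0.
rewrite E lerXn2r ?nnegrE ?expR_ge0//=.
rewrite -lerBlDl; apply: le_trans (ler_subX _ b0 e1 _) _.
  by rewrite -expR0 ler_expR oppr_le0.
have e2 : expR (- s) <= (1 + s)^-1.
  by rewrite expRN lef_pV2 ?posrE ?expR_gt0 ?expR_ge1Dx// ltr_pwDl.
have -> : t ^+ 2 / p.+1%:R = p.+1%:R * s ^+ 2.
  by rewrite /s; field; rewrite nat1r pnatr_eq0.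
rewrite ler_pM2l//; apply: le_trans (lerB e2 (lexx _)) _.
have s1p : 0 < 1 + s by rewrite ltr_pwDl.
have -> : (1 + s)^-1 - (1 - s) = s ^+ 2 / (1 + s) by field; rewrite gt_eqF.
by rewrite ler_pdivrMr// ler_peMr ?sqr_ge0// lerDl.
Qed.

Lemma cvg_exp_sub t : 0 <= t -> (1 - t / p%:R) ^+ p @[p --> \oo] --> expR (- t).
Proof.
move=> t0.
have h : expR (- t) - t ^+ 2 / p%:R @[p --> \oo] --> expR (- t).
  rewrite -[X in _ --> X]subr0; apply: cvgB; first exact: cvg_cst.
  rewrite -(mulr0 (t ^+ 2)); apply: cvgM; first exact: cvg_cst.
  by rewrite -cvg_shiftS; exact: cvg_harmonic.
apply: (@squeeze_cvgr _ _ _ _ (fun p => expR (- t) - t ^+ 2 / p%:R)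
  (fun=> expR (- t))) => //.
  near=> p.
  have : 0 <= t <= p%:R by rewrite t0/=; near: p; exact: nbhs_infty_ger.
  by move=> /exp_sub_bounds/andP[-> ?]; rewrite lerBlDr andbT.
exact: cvg_cst.
Unshelve. all: by end_near. Qed.

Lemma integrable_gamma s : 0 < s ->
  mu.-integrable `]0, +oo[
    (EFin \o (fun t : R => expR (- t) * expR ((s - 1) * ln t))).
Proof.
move=> s0; pose m := (Num.truncn s).+1.
(* On ]0, 1] the integrand is at most t ^ (s - 1).  For t > 1 it is at most
   t ^ m exp (- t), and t ^ m <= m! 2 ^ m exp (t / 2); the last factor 2 of K
   undoes the normalization of the exponential density of rate 1/2. *)
have sm : s < m%:R by exact: truncnS_gt.
pose K : R := m`!%:R * 2 ^+ m * 2.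
pose g1 : R -> R := (fun t => expR ((s - 1) * ln t)) \_ `]0, 1].
pose g t := g1 t + K * exponential_pdf (2^-1) t.
have ig : mu.-integrable `]0, +oo[ (EFin \o g).
  rewrite (_ : EFin \o g =
    ((EFin \o g1) \+ (fun t => K%:E * (exponential_pdf (2^-1) t)%:E))%E)//.
  apply: integrableD => //.
    rewrite /g1 -restrict_EFin; apply/integrable_restrict => //.
    rewrite (_ : _ `&` _ = `]0, 1]%classic); first exact: integrable_expRln.
    by apply/setIidPr => x/=; rewrite !in_itv/= => /andP[->].
  apply: integrableZl => //;
    apply: integrableS (integrable_exponential_pdf _) => //.
apply: le_integrable ig => //.
  apply/measurable_EFinP; apply: measurable_funM; last exact: measurable_expRln.
  by apply: measurable_funTS; apply: measurableT_comp => //;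
    exact: measurable_oppr.
move=> t; rewrite /= in_itv/= andbT => t0; rewrite lee_fin.
rewrite ger0_norm; last by rewrite mulr_ge0 ?expR_ge0.
apply: le_trans (ler_norm _); rewrite /g /g1.
have [t1|t1] := leP t 1.
  rewrite patchE mem_set/=; last by rewrite in_itv/= t0.
  rewrite -[leLHS]addr0 lerD//.
    by rewrite ler_piMl ?expR_ge0// -expR0 ler_expR oppr_le0 ltW.
  by rewrite mulr_ge0 ?exponential_pdf_ge0 ?invr_ge0// /K !mulr_ge0// exprn_ge0.
rewrite patchE memNset/=; last by rewrite in_itv/= t0/= leNgt t1.
rewrite add0r exponential_pdfE; last exact: ltW.
rewrite [leRHS](_ : _ = m`!%:R * 2 ^+ m * expR (t / 2) * expR (- t));
  last first.
  rewrite -[RHS]mulrA -expRD (_ : t / 2 + - t = - 2^-1 * t); last by field.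
  by rewrite /K; field.
rewrite mulrC ler_wpM2r ?expR_ge0//.
apply: (@le_trans _ _ (t ^+ m)).
  rewrite -[t in leRHS]lnK ?posrE// -expRM_natl ler_expR ler_wpM2r ?ln_ge0
    1?ltW//.
  by apply: lt_le_trans (ltW sm); rewrite gtrBl.
have h := expR_ge1Dxn (Num.truncn s) (divr_ge0 (ltW t0) (ler0n R 2)).
apply: (@le_trans _ _ (m`!%:R * 2 ^+ m * ((t / 2) ^+ m / m`!%:R))).
  rewrite le_eqVlt; apply/orP; left; apply/eqP; rewrite exprMn exprVn; field.
  by rewrite !pnatr_eq0 -lt0n fact_gt0 expf_neq0 ?pnatr_eq0.
rewrite ler_wpM2l ?mulr_ge0 ?exprn_ge0//.
by apply: le_trans h; rewrite lerDr.
Qed.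

(** Dominated convergence: applied below with h the real and the imaginary
    part of t ^ (z - 1), and s the real part of z. *)
Lemma cvg_Rintegral_exp_sub (h : R -> R) s : 0 < s -> measurable_fun setT h ->
  (forall t, 0 < t -> `|h t| <= expR ((s - 1) * ln t)) ->
  \int[mu]_(t in `]0, p%:R]) ((1 - t / p%:R) ^+ p * h t) @[p --> \oo] -->
  \int[mu]_(t in `]0, +oo[) (expR (- t) * h t).
Proof.
move=> s0 mh leh; set D := `]0, +oo[%classic.
pose f_ p : R -> R := (fun t => (1 - t / p%:R) ^+ p * h t) \_ `]0, p%:R].
have E p : \int[mu]_(t in `]0, p%:R]) ((1 - t / p%:R) ^+ p * h t) =
  \int[mu]_(t in D) f_ p t.
  rewrite -Rintegral_mkcondr; congr Rintegral.
  by apply/esym/setIidPr => x/=; rewrite /D/= !in_itv/= => /andP[->].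
under eq_cvg do rewrite E.
have mD : measurable D by exact: measurable_itv.
have mpow p : measurable_fun setT (fun t : R => (1 - t / p%:R) ^+ p * h t).
  apply: measurable_funM => //; apply: measurable_funX.
  by apply: measurable_funB => //; exact: measurable_funM.
have mf p : measurable_fun D (EFin \o f_ p).
  apply/measurable_EFinP; apply/measurable_restrict => //.
  exact: measurable_funTS.
have me : measurable_fun D (EFin \o (fun t => expR (- t) * h t)).
  apply/measurable_EFinP; apply: measurable_funM; last exact: measurable_funTS.
  by apply: measurable_funTS; apply: measurableT_comp => //;
    exact: measurable_oppr.
have [|||i1 _ i2] := @dominated_convergence _ _ R mu D mD
  (fun p => EFin \o f_ p) (EFin \o (fun t => expR (- t) * h t))
  (EFin \o (fun t => expR (- t) * expR ((s - 1) * ln t))) mf me.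
- apply: aeW => t; rewrite /D/= in_itv/= andbT => t0.
  apply: cvg_EFin; first exact: nearW.
  have H : (1 - t / p%:R) ^+ p * h t @[p --> \oo] --> expR (- t) * h t.
    by apply: cvgM; [exact: cvg_exp_sub (ltW t0)|exact: cvg_cst].
  apply: cvg_trans H; apply: near_eq_cvg; near=> p.
  rewrite /f_ /= patchE mem_set//= in_itv/= t0/=; near: p;
    exact: nbhs_infty_ger.
- exact: integrable_gamma.
- apply: aeW => t p; rewrite /D/= in_itv/= andbT => t0.
  rewrite lee_fin /f_ patchE.
  case: ifPn => [|_]; last by rewrite normr0 mulr_ge0 ?expR_ge0.
  rewrite inE/= in_itv/= => /andP[_ tp].
  have := @exp_sub_bounds t p; rewrite (ltW t0) tp => /(_ isT)/andP[le1 _].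
  have p0 : 0 < p%:R :> R by exact: lt_le_trans tp.
  have ge0 : 0 <= (1 - t / p%:R) ^+ p.
    by rewrite exprn_ge0// subr_ge0 ler_pdivrMr// mul1r.
  by rewrite normrM (ger0_norm ge0) ler_pM//; exact: leh.
have fin : (\int[mu]_(t in D) (expR (- t) * h t)%:E)%E \is a fin_num.
  exact: integrable_fin_num i1.
by rewrite /Rintegral; apply: fine_cvg; rewrite fineK.
Unshelve. all: by end_near. Qed.

End ExpLimit.

(** * Gauss's product formula for Gamma *)

Section ComplexLimits.
Variable R : realType.
Local Notation C := (cplx R).
Local Notation mu := (@lebesgue_measure R).
Implicit Types (z w c : C).

Lemma complex_eq z w :
  complex.Re z = complex.Re w -> complex.Im z = complex.Im w -> z = w.
Proof. by case: z w => a b [u v] /= -> ->. Qed.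

Lemma normC_real (a : R) : `|a%:C%C : C| = (`|a|)%:C%C.
Proof. by rewrite normc_def/= expr0n/= addr0 sqrtr_sqr. Qed.

Lemma normC_le_parts z : `|z| <= (`|complex.Re z| + `|complex.Im z|)%:C%C.
Proof.
rewrite [z in leLHS]complexE (le_trans (ler_normD _ _))// normrM normC_real.
rewrite normC_real normc_def /= expr0n expr1n add0r sqrtr1 mul1r.
by rewrite lecE /= !addr0 eqxx lexx.
Qed.

Lemma cvg_complex (T : Type) (F : set_system T) {FF : Filter F}
    (u : T -> C) (l : C) :
  complex.Re (u x) @[x --> F] --> complex.Re l ->
  complex.Im (u x) @[x --> F] --> complex.Im l -> u x @[x --> F] --> l.
Proof.
move=> /cvgrPdist_lt hr /cvgrPdist_lt hi; apply/cvgrPdist_lt => e e0.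
(* a positive complex number is a positive real *)
have [er erE e0r] : exists2 er : R, e = er%:C%C & 0 < er.
  exists (complex.Re e).
    by apply: complex_eq => //=; move: e0; rewrite ltcE => /andP[/eqP].
  by move: e0; rewrite ltcE => /andP[].
have e2 : 0 < er / 2 by rewrite divr_gt0.
near=> x.
apply: (le_lt_trans (normC_le_parts _)); rewrite erE ltcE/= eqxx/=.
have -> : complex.Re (l - u x) = complex.Re l - complex.Re (u x).
  by case: (l) (u x) => ? ? [].
have -> : complex.Im (l - u x) = complex.Im l - complex.Im (u x).
  by case: (l) (u x) => ? ? [].
by rewrite [ltRHS]splitr ltrD//; near: x; [exact: hr|exact: hi].
Unshelve. all: by end_near. Qed.

(** Integrability of a complex-valued function: of its real and imaginary
    parts, which is what makes [cintegral] meaningful. *)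
Definition cintegrable (D : set (measurableTypeR R)) (f : R -> C) :=
  mu.-integrable D (EFin \o (fun t => complex.Re (f t))) /\
  mu.-integrable D (EFin \o (fun t => complex.Im (f t))).

Lemma eq_cintegral (D : set (measurableTypeR R)) (f g : R -> C) :
  {in D, f =1 g} -> cintegral D f = cintegral D g.
Proof.
by move=> fg; rewrite /cintegral; congr (_ +i* _)%C;
  apply: eq_Rintegral => x xD; rewrite fg.
Qed.

Lemma cintegralB (D : set (measurableTypeR R)) (f g : R -> C) : measurable D ->
  cintegrable D f -> cintegrable D g ->
  cintegral D (fun t => f t - g t) = cintegral D f - cintegral D g.
Proof.
move=> mD [fr fi] [gr gi]; apply: complex_eq => /=.
- by rewrite -RintegralB//; apply: eq_Rintegral => x _;
  case: (f x) (g x) => ? ? [].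
- by rewrite -RintegralB//; apply: eq_Rintegral => x _;
  case: (f x) (g x) => ? ? [].
Qed.

Lemma cintegralZ (D : set (measurableTypeR R)) (f : R -> C) (a : R) :
  measurable D ->
  cintegrable D f ->
  cintegral D (fun t => a%:C%C * f t) = a%:C%C * cintegral D f.
Proof.
move=> mD [fr fi]; apply: complex_eq => /=; rewrite mul0r ?subr0 ?addr0.
- rewrite -RintegralZl//; apply: eq_Rintegral => x _.
  by case: (f x) => ? ? /=; rewrite mul0r subr0.
- rewrite -RintegralZl//; apply: eq_Rintegral => x _.
  by case: (f x) => ? ? /=; rewrite mul0r addr0.
Qed.

Lemma cintegrableZ (D : set (measurableTypeR R)) (f : R -> C) (a : R) :
  measurable D ->
  cintegrable D f -> cintegrable D (fun t => a%:C%C * f t).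
Proof.
move=> mD [fr fi]; split.
- have := integrableZl mD a fr; apply: eq_integrable => // x _ /=.
  by rewrite -EFinM; case: (f x) => ? ? /=; rewrite mul0r subr0.
- have := integrableZl mD a fi; apply: eq_integrable => // x _ /=.
  by rewrite -EFinM; case: (f x) => ? ? /=; rewrite mul0r addr0.
Qed.

Lemma cintegral_cpow z (b : R) : 0 < complex.Re z -> 0 < b ->
  z * cintegral `]0, b] (fun t => cpow t (z - 1)) = cpow b z.
Proof.
move=> z0 b0.
have iR := integrable_Re_cpow b z0; have iI := integrable_Im_cpow b z0.
have mD : measurable (`]0, b] : set (measurableTypeR R)).
  exact: measurable_itv.
have iZ (a : R) (f : R -> R) : mu.-integrable `]0, b] (EFin \o f) ->
  mu.-integrable `]0, b] (EFin \o (fun t => a * f t)).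
  by move=> fi; have := integrableZl mD a fi;
    apply: eq_integrable => // x _ /=; rewrite EFinM.
apply: complex_eq.
- transitivity (\int[mu]_(t in `]0, b])
      (complex.Re z * complex.Re (cpow t (z - 1)) -
       complex.Im z * complex.Im (cpow t (z - 1)))).
    rewrite RintegralB ?RintegralZl//; [|exact: iZ|exact: iZ].
    by case: z {z0 iR iI}.
  apply: (Rintegral_FTC_at0 (F := fun t => complex.Re (cpow t z)) z0 b0).
  + move=> x; exact: is_derive_Re_cpow.
  + move=> x x0; apply: cvgB; apply: cvgM; try exact: cvg_cst.
      exact: continuous_Re_cpow.
    exact: continuous_Im_cpow.
  + by move=> x _; exact: le_Re_cpow.
  + have := integrableB mD (iZ (complex.Re z) _ iR) (iZ (complex.Im z) _ iI).
    by apply: eq_integrable => // x _ /=; rewrite EFinB.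
- transitivity (\int[mu]_(t in `]0, b])
      (complex.Re z * complex.Im (cpow t (z - 1)) +
       complex.Im z * complex.Re (cpow t (z - 1)))).
    rewrite RintegralD ?RintegralZl//; [|exact: iZ|exact: iZ].
    by case: z {z0 iR iI}.
  apply: (Rintegral_FTC_at0 (F := fun t => complex.Im (cpow t z)) z0 b0).
  + move=> x; exact: is_derive_Im_cpow.
  + move=> x x0; apply: cvgD; apply: cvgM; try exact: cvg_cst.
      exact: continuous_Im_cpow.
    exact: continuous_Re_cpow.
  + by move=> x _; exact: le_Im_cpow.
  + have := integrableD mD (iZ (complex.Re z) _ iI) (iZ (complex.Im z) _ iR).
    by apply: eq_integrable => // x _ /=; rewrite EFinD.
Qed.

(** The integral of (1 - t/p)^m t^(z-1) over ]0, p].  The exponent m is kept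
    separate from p so that the integral can be computed by induction on m. *)
Definition beta_integral (p m : nat) z : C :=
  cintegral `]0, p%:R] (fun t => ((1 - t / p%:R) ^+ m)%:C%C * cpow t (z - 1)).

Lemma Re_realM (a : R) z : complex.Re (a%:C%C * z) = a * complex.Re z.
Proof. by case: z => ? ? /=; rewrite mul0r subr0. Qed.

Lemma Im_realM (a : R) z : complex.Im (a%:C%C * z) = a * complex.Im z.
Proof. by case: z => ? ? /=; rewrite mul0r addr0. Qed.

Lemma cpowD (t : R) z w : cpow t (z + w) = cpow t z * cpow t w.
Proof.
case: z w => a b [c d]; apply: complex_eq.
- rewrite Re_cpow /= !mulrDl expRD cosD /cpow /cexp /=.
  rewrite !mulr0 !subr0 !add0r !mul0r !subr0 !addr0; ring.
- rewrite Im_cpow /= !mulrDl expRD sinD /cpow /cexp /=.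
  rewrite !mulr0 !subr0 !add0r !mul0r !subr0 !addr0; ring.
Qed.

Lemma cpow0 (t : R) : cpow t 0 = 1.
Proof.
by rewrite /cpow /cexp mul0r /= expR0 cos0 sin0; apply: complex_eq => /=; ring.
Qed.

Lemma cpow1 (t : R) : 0 < t -> cpow t 1 = t%:C%C.
Proof.
by move=> t0; apply: complex_eq;
  rewrite ?Re_cpow ?Im_cpow /= mul1r mul0r lnK ?posrE// ?cos0 ?sin0 ?mulr1
  ?mulr0.
Qed.

Lemma cintegrable_beta p m z : 0 < complex.Re z ->
  cintegrable `]0, p%:R] (fun t => ((1 - t / p%:R) ^+ m)%:C%C * cpow t (z - 1)).
Proof.
move=> z0.
have mD : measurable (`]0, p%:R] : set (measurableTypeR R)).
  exact: measurable_itv.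
have mp : measurable_fun (`]0, p%:R] : set R)
    (fun t : R => (1 - t / p%:R) ^+ m).
  apply: measurable_funTS; apply: measurable_funX; apply: measurable_funB => //.
  exact: measurable_funM.
have le1 (t : R) : t \in `]0, p%:R] -> `|(1 - t / p%:R) ^+ m| <= 1.
  rewrite in_itv/= => /andP[t0 tp].
  have p0 : 0 < p%:R :> R by exact: lt_le_trans tp.
  rewrite normrX exprn_ile1// ger0_norm ?subr_ge0 ?ler_pdivrMr ?mul1r//.
  by rewrite gerBl divr_ge0// ltW.
split.
- rewrite (_ : (fun t => complex.Re _) =
  (fun t : R => (1 - t / p%:R) ^+ m * complex.Re (cpow t (z - 1)))); last first.
    by apply/funext => t; exact: Re_realM.
  apply: le_integrable (integrable_Re_cpow p%:R z0) => //.
    by apply/measurable_EFinP; apply: measurable_funM => //;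
      exact: measurable_Re_cpow.
  by move=> t tD; rewrite /comp !abse_EFin lee_fin normrM ler_piMl// le1.
- rewrite (_ : (fun t => complex.Im _) =
  (fun t : R => (1 - t / p%:R) ^+ m * complex.Im (cpow t (z - 1)))); last first.
    by apply/funext => t; exact: Im_realM.
  apply: le_integrable (integrable_Im_cpow p%:R z0) => //.
    by apply/measurable_EFinP; apply: measurable_funM => //;
      exact: measurable_Im_cpow.
  by move=> t tD; rewrite /comp !abse_EFin lee_fin normrM ler_piMl// le1.
Qed.

(** From (1 - t/p)^(m+1) = (1 - t/p)^m - (t/p) (1 - t/p)^m. *)
Lemma beta_integralS p m z : (0 < p)%N -> 0 < complex.Re z ->
  beta_integral p m.+1 z =
    beta_integral p m z - p%:R^-1 * beta_integral p m (z + 1).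
Proof.
move=> p0 z0.
have pC : p%:R^-1 = (p%:R^-1)%:C%C :> C by rewrite fmorphV rmorph_nat.
have mD : measurable (`]0, p%:R] : set (measurableTypeR R)).
  exact: measurable_itv.
have z1 : 0 < complex.Re (z + 1) by case: (z) z0 => a b /= a0; rewrite ltr_pwDl.
have i0 := cintegrable_beta p m z0; have i1 := cintegrable_beta p m z1.
rewrite pC /beta_integral -(cintegralZ _ mD i1) -cintegralB//.
- apply: eq_cintegral => t; rewrite inE/= in_itv/= => /andP[t0 tp].
  have -> : z + 1 - 1 = (z - 1) + 1 by ring.
  rewrite (cpowD t (z - 1) 1) cpow1// exprS rmorphM rmorphB rmorph1 rmorphM;
    ring.
- exact: cintegrableZ.
Qed.

Lemma Re_addn_gt0 z q : 0 < complex.Re z -> 0 < complex.Re (z + q%:R).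
Proof.
move=> z0; have -> : q%:R = (q%:R)%:C%C :> C by rewrite rmorph_nat.
by case: z z0 => a b /= a0; rewrite ltr_wpDr.
Qed.

Lemma addn_neq0 z q : 0 < complex.Re z -> z + q%:R != 0.
Proof.
by move=> /(Re_addn_gt0 q) h; apply: contraTneq h => ->; rewrite ltxx.
Qed.

Lemma beta_integralE p m z : (0 < p)%N -> 0 < complex.Re z ->
  beta_integral p m z = cpow p%:R z * m`!%:R / \prod_(q < m.+1) (z + q%:R).
Proof.
move=> p0; elim: m z => [|m ih] z z0; have zq := addn_neq0 _ z0.
  rewrite big_ord_recl big_ord0 mulr1 addr0 fact0 mulr1.
  have nz := zq 0%N; rewrite addr0 in nz.
  rewrite -(@cintegral_cpow z)// ?ltr0n// mulrAC divff// mul1r.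
  by apply: eq_cintegral => t _; rewrite expr0 mul1r.
have pz1 := Re_addn_gt0 1 z0.
rewrite beta_integralS// !ih// cpowD cpow1 ?ltr0n//.
set P := \prod_(q < m.+1) (z + 1 + q%:R).
have Pn0 : P != 0.
  by apply/prodf_neq0 => q _; rewrite -addrA nat1r zq.
have -> : \prod_(q < m.+2) (z + q%:R) = z * P.
  rewrite big_ord_recl addr0; congr (_ * _); apply: eq_bigr => q _.
  by rewrite /= -addrA nat1r.
have E : (\prod_(q < m.+1) (z + q%:R)) * (z + m.+1%:R) = z * P.
  transitivity (\prod_(q < m.+2) (z + q%:R)).
    by rewrite [RHS]big_ord_recr.
  rewrite big_ord_recl addr0; congr (_ * _); apply: eq_bigr => q _.
  by rewrite /= -addrA nat1r.
have nz : z != 0 by have := zq 0%N; rewrite addr0.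
have Qn0 : \prod_(q < m.+1) (z + q%:R) != 0 by apply/prodf_neq0.
have -> : \prod_(q < m.+1) (z + q%:R) = z * P / (z + m.+1%:R).
  by rewrite -E mulfK.
rewrite rmorph_nat factS natrM; field.
by rewrite Pn0 nz nat1r zq pnatr_eq0 -lt0n p0.
Qed.

(** The p-th term p^z p! / (z (z + 1) ... (z + p)) of Gauss's formula; the
    product has p + 1 factors. *)
Definition gauss p z : C := cpow p%:R z * p`!%:R / \prod_(q < p.+1) (z + q%:R).

Lemma cvg_gauss z : 0 < complex.Re z -> gauss p z @[p --> \oo] --> Gamma z.
Proof.
move=> z0; rewrite /Gamma /gamma_shift z0 big_ord0 divr1 addr0.
have Rz1 : complex.Re (z - 1) = complex.Re z - 1 by case: (z).
have cb : beta_integral p p z @[p --> \oo] --> gamma_integral z.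
  apply: cvg_complex.
  - rewrite (_ : (fun p => complex.Re _) =
      (fun p => \int[mu]_(t in `]0, p%:R])
         ((1 - t / p%:R) ^+ p * complex.Re (cpow t (z - 1))))); last first.
      by apply/funext => p; apply: eq_Rintegral => t _; exact: Re_realM.
    rewrite (_ : complex.Re (gamma_integral z) =
      \int[mu]_(t in `]0, +oo[) (expR (- t) * complex.Re (cpow t (z - 1))));
      last first.
      by apply: eq_Rintegral => t _; exact: Re_realM.
    apply: cvg_Rintegral_exp_sub z0 _ _; first exact: measurable_Re_cpow.
    by move=> t _; rewrite -Rz1; exact: le_Re_cpow.
  - rewrite (_ : (fun p => complex.Im _) =
      (fun p => \int[mu]_(t in `]0, p%:R])
         ((1 - t / p%:R) ^+ p * complex.Im (cpow t (z - 1))))); last first.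
      by apply/funext => p; apply: eq_Rintegral => t _; exact: Im_realM.
    rewrite (_ : complex.Im (gamma_integral z) =
      \int[mu]_(t in `]0, +oo[) (expR (- t) * complex.Im (cpow t (z - 1))));
      last first.
      by apply: eq_Rintegral => t _; exact: Im_realM.
    apply: cvg_Rintegral_exp_sub z0 _ _; first exact: measurable_Im_cpow.
    by move=> t _; rewrite -Rz1; exact: le_Im_cpow.
apply: cvg_trans cb; apply: near_eq_cvg; near=> p.
by rewrite beta_integralE//; near: p; exact: nbhs_infty_gt.
Unshelve. all: by end_near. Qed.

End ComplexLimits.

(** * Nonvanishing of Gamma and convergence of products *)

Lemma sum_inv_sqr_le2 (F : numFieldType) p :
  \sum_(q < p) (q.+1%:R ^+ 2)^-1 <= 2 :> F.
Proof.
(* telescoping, since 1/(q + 2)^2 <= 1/(q + 1) - 1/(q + 2) *)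
suff h : \sum_(q < p.+1) (q.+1%:R ^+ 2)^-1 <= 2 - p.+1%:R^-1 :> F.
  apply: (@le_trans _ _ (2 - p.+1%:R^-1)); last by rewrite gerBl invr_ge0.
  by apply: le_trans h; rewrite big_ord_recr/= lerDl invr_ge0 exprn_ge0.
elim: p => [|p ih].
  by rewrite big_ord_recr big_ord0 /= add0r expr1n invr1 (_ : 2 - 1 = 1)//; ring.
rewrite big_ord_recr/=; apply: le_trans (lerD ih (lexx _)) _.
rewrite -subr_ge0.
have -> : 2 - p.+2%:R^-1 - (2 - p.+1%:R^-1 + (p.+2%:R ^+ 2)^-1) =
  (p.+1%:R * p.+2%:R ^+ 2)^-1 :> F.
  have -> : p.+2%:R = p.+1%:R + 1 :> F by rewrite natr1.
  have h1 : p.+1%:R != 0 :> F by rewrite pnatr_eq0.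
  have h2 : p.+1%:R + 1 != 0 :> F by rewrite natr1 pnatr_eq0.
  move: (p.+1%:R : F) h1 h2 => u h1 h2; field; by rewrite h1 h2.
by rewrite invr_ge0 mulr_ge0 ?exprn_ge0.
Qed.

Section GammaProducts.
Variable R : realType.
Local Notation C := (cplx R).
Implicit Types (z w c : C).

Lemma cpow_neq0 (t : R) z : cpow t z != 0.
Proof.
apply/eqP => h; have := cpow0 t; rewrite -(subrr z) cpowD h mul0r => /eqP.
by rewrite eq_sym oner_eq0.
Qed.

Lemma gauss_neq0 p z : 0 < complex.Re z -> gauss p z != 0.
Proof.
move=> z0; apply: mulf_neq0.
  by apply: mulf_neq0; rewrite ?cpow_neq0// pnatr_eq0 -lt0n fact_gt0.
by apply: invr_neq0; apply/prodf_neq0 => q _; exact: addn_neq0.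
Qed.

Lemma prod_addn_gauss p z y : 0 < complex.Re z -> 0 < complex.Re y ->
  \prod_(q < p.+1) ((z + q%:R) / (y + q%:R)) =
    gauss p y / gauss p z * cpow p%:R (z - y).
Proof.
move=> z0 y0; rewrite prodf_div /gauss cpowD.
have zP : \prod_(q < p.+1) (z + q%:R) != 0.
  by apply/prodf_neq0 => q _; exact: addn_neq0.
have yP : \prod_(q < p.+1) (y + q%:R) != 0.
  by apply/prodf_neq0 => q _; exact: addn_neq0.
have E : cpow p%:R y * cpow p%:R (- y) = 1 :> C by rewrite -cpowD subrr cpow0.
have -> : cpow p%:R (- y) = (cpow p%:R y)^-1 :> C.
  by apply: (mulfI (cpow_neq0 p%:R y)); rewrite E divff// cpow_neq0.
field; rewrite zP yP !cpow_neq0 pnatr_eq0 -lt0n fact_gt0//.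
Qed.

Lemma cpow_sum (I : finType) (t : R) (u : I -> C) :
  \prod_i cpow t (u i) = cpow t (\sum_i u i).
Proof. by elim/big_rec2 : _ => [|i a b _ ->]; rewrite ?cpow0 ?cpowD. Qed.

(** The bound is exp (2 |c|), from 1 + u <= exp u. *)
Lemma prod_sub_inv_sqr_bounded c : exists2 K : R, 0 < K &
  forall p, `|\prod_(q < p) (1 - c / q.+1%:R ^+ 2)| <= K%:C%C :> C.
Proof.
pose b := complex.Re `|c|.
have bE : `|c| = b%:C%C by rewrite /b normc_def.
have b0 : 0 <= b by have := normr_ge0 c; rewrite bE lecE /= => /andP[].
exists (expR (b * 2)); first exact: expR_gt0.
move=> p; rewrite normr_prod.
apply: (@le_trans _ _ (\prod_(q < p) (expR (b / q.+1%:R ^+ 2))%:C%C)).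
  apply: ler_prod => q _; rewrite normr_ge0/=.
  apply: le_trans (ler_normB _ _) _;
    rewrite normr1 normrM bE normfV normrX normr_nat.
  have -> : (q.+1%:R : C) = (q.+1%:R)%:C%C by rewrite rmorph_nat.
  rewrite -rmorphXn -fmorphV -rmorphM -(rmorph1 (real_complex R)) -rmorphD.
  by rewrite lecE /= eqxx expR_ge1Dx.
rewrite -rmorph_prod -expR_sum lecE/= eqxx/= ler_expR -mulr_sumr ler_wpM2l//.
exact: sum_inv_sqr_le2.
Qed.

Lemma gauss1 p : (0 < p)%N -> gauss p (1 : C) = p%:R / p.+1%:R.
Proof.
move=> p0; rewrite /gauss cpow1 ?ltr0n// rmorph_nat.
under eq_bigr do rewrite nat1r.
have -> : \prod_(q < p.+1) (q.+1%:R : C) = (p.+1)`!%:R.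
  rewrite fact_prod big_add1 big_mkord natr_prod//.
rewrite factS natrM; field.
by rewrite ?nat1r !pnatr_eq0 -?lt0n ?fact_gt0.
Qed.

(** The approximations at z and at 2 - z are compared with the one at 1:
    (z + q) (2 - z + q) / (1 + q)^2 = 1 - (z - 1)^2 / (1 + q)^2, whose products
    over q are bounded, so the product of the two approximations cannot tend
    to 0. *)
Lemma Gamma_neq0 z : 0 < complex.Re z < 2 -> Gamma z != 0.
Proof.
move=> /andP[z0 z2]; apply/eqP => Gz.
have y0 : 0 < complex.Re (2 - z).
  have -> : 2 = 2%:C%C :> C by rewrite rmorph_nat.
  by case: (z) z2 => a b /=; rewrite subr_gt0.
have o0 : 0 < complex.Re (1 : C) by [].
have [K K0 leK] := prod_sub_inv_sqr_bounded ((z - 1) ^+ 2).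
have E p : (0 < p)%N ->
    gauss p z * gauss p (2 - z) *
      \prod_(q < p.+1) (1 - (z - 1) ^+ 2 / q.+1%:R ^+ 2) = gauss p 1 ^+ 2.
  move=> p0.
  have -> : \prod_(q < p.+1) (1 - (z - 1) ^+ 2 / q.+1%:R ^+ 2) =
     \prod_(q < p.+1) ((z + q%:R) / (1 + q%:R)) *
       \prod_(q < p.+1) ((2 - z + q%:R) / (1 + q%:R)).
    rewrite -big_split/=; apply: eq_bigr => q _; rewrite -nat1r; field.
    by rewrite nat1r pnatr_eq0.
  rewrite !prod_addn_gauss// [X in X = _](_ : _ = gauss p 1 ^+ 2 *
    (cpow p%:R (z - 1) * cpow p%:R (2 - z - 1))); last first.
    by field; rewrite !gauss_neq0.
  by rewrite -cpowD (_ : z - 1 + (2 - z - 1) = 0) ?cpow0 ?mulr1//; ring.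
have cg : gauss p z * gauss p (2 - z) @[p --> \oo] --> 0.
  by rewrite -(mul0r (Gamma (2 - z))) -Gz; apply: cvgM; exact: cvg_gauss.
have KC : 0 < K%:C%C :> C by rewrite ltcE /= eqxx.
have e0 : 0 < (4 * K%:C%C)^-1 :> C by rewrite invr_gt0 mulr_gt0.
have /cvgr0Pnorm_lt/(_ _ e0) h := cg.
near \oo => p.
have p0 : (0 < p)%N by near: p; exact: nbhs_infty_gt.
have : `|gauss p z * gauss p (2 - z)| < (4 * K%:C%C)^-1 by near: p.
rewrite -(ltr_pM2r KC) invfM mulfVK ?gt_eqF// => hK.
(* but the approximation p / (p + 1) of Gamma 1 is at least 1/2 *)
have : `|gauss p (1 : C) ^+ 2| < 4^-1.
  by rewrite -E// normrM; apply: le_lt_trans hK; rewrite ler_wpM2l.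
apply/negP; rewrite le_gtF//.
rewrite gauss1// normrX ger0_norm ?divr_ge0//.
rewrite (_ : 4^-1 = 2^-1 ^+ 2); last by field.
rewrite lerXn2r ?nnegrE ?invr_ge0 ?divr_ge0// ler_pdivlMr ?ltr0n//.
by rewrite mulrC ler_pdivrMr// -natrM ler_nat; lia.
Unshelve. all: by end_near. Qed.

(** As the z i and the y i have equal sums, the powers of p in Gauss's formula
    cancel in the quotient. *)
Lemma cvg_gamma_prod (I : finType) (z y : I -> C) :
  (forall i, 0 < complex.Re (z i) < 2) -> (forall i, 0 < complex.Re (y i)) ->
  \sum_i z i = \sum_i y i ->
  \prod_i \prod_(q < p.+1) ((z i + q%:R) / (y i + q%:R)) @[p --> \oo] -->
  \prod_i (Gamma (y i) / Gamma (z i)).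
Proof.
move=> hz hy zy.
have z0 i : 0 < complex.Re (z i) by case/andP: (hz i).
have -> : (fun p => \prod_i \prod_(q < p.+1) ((z i + q%:R) / (y i + q%:R))) =
  (fun p => \prod_i (gauss p (y i) / gauss p (z i))).
  apply/funext => p; under eq_bigr do rewrite prod_addn_gauss//.
  by rewrite big_split/= cpow_sum sumrB zy subrr cpow0 mulr1.
elim: (index_enum I) => [|i r ih].
  by under eq_cvg do rewrite big_nil; rewrite big_nil; exact: cvg_cst.
under eq_cvg do rewrite big_cons; rewrite big_cons.
apply: cvgM ih; apply: cvgM; first exact: cvg_gauss.
by apply: cvgV; [exact: Gamma_neq0|exact: cvg_gauss].
Qed.

End GammaProducts.

(** * Sums over weakly increasing tuples *)

Section Combinatorics.
Variables (F : fieldType) (N : nat) (a : nat -> F).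

(** The summand of a tuple s when the index i carries the coefficient a i. *)
Definition eps_weight (s : seq nat) : F :=
  (eps_seq N s)%:R * \prod_(i <- s) a i.

Lemma eps_seq_cons m h s : eps_seq N [:: m, h & s] =
  (eps N m h * eps_seq N (h :: s))%N.
Proof. by rewrite /eps_seq /= big_ord_recl. Qed.

(** Prepending m to s: when N does not divide m the factor eps forbids a
    second m, so that the remaining entries are at least m + 1. *)
Lemma eps_weight_cons m s :
  (if path leq m s then eps_weight (m :: s) else 0) =
  a m *
    (if path leq (if (N %| m)%N then m else m.+1) s then eps_weight s else 0).
Proof.
case: s => [|h s].
  by rewrite /= /eps_weight /eps_seq !big_ord0 big_cons big_nil !mul1r.
rewrite /eps_weight eps_seq_cons big_cons /= /eps.
have [Nm|Nm] := boolP (N %| m)%N.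
  by rewrite andbF mul1n; case: ifP => _; rewrite ?mulr0//; ring.
rewrite andbT; case: ltngtP => mh /=; rewrite ?mulr0//.
- by rewrite mul1n; case: ifP => _; rewrite ?mulr0//; ring.
- by rewrite mul0n mul0r if_same.
Qed.

(** The sum S_k restricted to tuples with entries in [m, X]. *)
Definition eps_sum (X k m : nat) : F :=
  \sum_(t : k.-tuple 'I_X.+1 | path leq m [seq val i | i <- t])
    eps_weight [seq val i | i <- t].

Lemma big_tuple_cons (T : finType) k (G : k.+1.-tuple T -> F) :
  \sum_t G t = \sum_x \sum_(t : k.-tuple T) G [tuple of x :: t].
Proof.
rewrite pair_big /=.
rewrite (reindex (fun p : T * k.-tuple T => [tuple of p.1 :: p.2])) //=.
exists (fun t : k.+1.-tuple T => (thead t, [tuple of behead t])) =>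
  [[x t] _|t _] /=.
  by rewrite theadE; congr (_, _); apply: val_inj.
by rewrite -tuple_eta.
Qed.

Lemma eps_sum0 X m : eps_sum X 0 m = 1.
Proof.
rewrite /eps_sum (big_pred1 [tuple]); last by move=> t; rewrite tuple0 /= eqxx.
by rewrite /eps_weight /eps_seq /= big_ord0 big_nil mulr1.
Qed.

Lemma eps_sumSE X k m : eps_sum X k.+1 m =
  \sum_(x < X.+1 | (m <= x)%N)
    (a x * eps_sum X k (if (N %| x)%N then (x : nat) else x.+1)).
Proof.
rewrite /eps_sum big_mkcond big_tuple_cons [RHS]big_mkcond.
apply: eq_bigr => x _ /=.
case: ifPn => mx; last by rewrite big1.
rewrite [in RHS]big_mkcond mulr_sumr; apply: eq_bigr => t _.
by rewrite -eps_weight_cons.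
Qed.

(** Sorting by the multiplicity of the smallest admissible entry m: it is
    arbitrary if N divides m, and at most one otherwise. *)
Lemma eps_sumS X k m : (m <= X)%N ->
  eps_sum X k.+1 m = eps_sum X k.+1 m.+1 +
    a m * eps_sum X k (if (N %| m)%N then m else m.+1).
Proof.
move=> mX; rewrite !eps_sumSE (bigD1 (inord m))/= ?inordK ?ltnS// addrC.
congr (_ + _).
by apply: eq_bigl => x;
  rewrite -val_eqE/= inordK ?ltnS// [RHS]ltn_neqAle eq_sym andbC.
Qed.

Lemma eps_sum_gt X k : eps_sum X k.+1 X.+1 = 0.
Proof. by rewrite eps_sumSE big_pred0// => x; rewrite leqNgt ltn_ord. Qed.

End Combinatorics.

(** * Newton's identities *)

Section Newton.
Variable F : fieldType.
Implicit Types (S c : nat -> F) (b : F).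

(** The coefficient of t^k in t dS/dt - S C, where S and C are the power series
    with coefficients S j and c j, C without constant term: Newton's identities
    say that it is 0.  The value c 0 is irrelevant. *)
Definition newton_defect S c k : F :=
  k%:R * S k - \sum_(j < k) c j.+1 * S (k - j.+1)%N.

(** Passing from S' to S = (1 + b t) S' adds b t / (1 + b t) to C and multiplies
    the defect by 1 + b t. *)
Lemma newton_defectS S S' c c' b k : S 0%N = S' 0%N ->
  (forall k, S k.+1 = S' k.+1 + b * S' k) ->
  (forall j, c j = c' j - (- b) ^+ j) ->
  newton_defect S c k.+1 = newton_defect S' c' k.+1 + b * newton_defect S' c' k.
Proof.
move=> S0 SS cc.
(* the geometric part of c telescopes *)
have T i : \sum_(j < i.+1) (- b) ^+ j.+1 * S (i - j)%N = - b * S' i.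
  elim: i => [|i ih];
    first by rewrite big_ord_recl big_ord0 /= expr1 subn0 S0 addr0.
  rewrite big_ord_recl expr1 subn0.
  under eq_bigr => j _ do rewrite lift0 subSS exprS -mulrA.
  by rewrite -mulr_sumr ih SS; ring.
have A : \sum_(j < k.+1) c' j.+1 * S (k - j)%N =
   \sum_(j < k.+1) c' j.+1 * S' (k - j)%N +
   b * \sum_(j < k) c' j.+1 * S' (k - j.+1)%N.
  rewrite !big_ord_recr /= subnn S0 addrAC; congr (_ + _).
  rewrite mulr_sumr -big_split /=; apply: eq_bigr => j _.
  by rewrite -(subnSK (ltn_ord j)) SS; ring.
rewrite /newton_defect.
under eq_bigr => j _ do rewrite cc mulrBl subSS.
rewrite sumrB A T SS -natr1.
under [in RHS]eq_bigr => j _ do rewrite subSS.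
by ring.
Qed.

End Newton.

Section NewtonEpsSum.
Variables (F : fieldType) (N : nat) (a : nat -> F).

(** For j > 0, the coefficient of t^j in t f' / f, where f is the factor
    1/(1 - a_i t) or 1 + a_i t contributed by the index i. *)
Definition log_coef (i j : nat) : F :=
  if (N %| i)%N then a i ^+ j else - (- a i) ^+ j.

Definition log_coef_sum (X m j : nat) : F := \sum_(m <= i < X.+1) log_coef i j.

Lemma newton_eps_sum X m k : (m <= X.+1)%N ->
  newton_defect (fun k => eps_sum N a X k m) (log_coef_sum X m) k = 0.
Proof.
(* induction on the number of admissible indices, adding the smallest one *)
move=> mX; rewrite -(subKn mX).
elim: (X.+1 - m)%N (leq_subr m X.+1) k => [|d ih] dX k.
  rewrite subn0 /newton_defect big1 ?subr0.
    by case: k => [|k]; rewrite ?mul0r// eps_sum_gt mulr0.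
  by move=> j _; rewrite /log_coef_sum big_geq// mul0r.
have {}ih := ih (ltnW dX).
set p := (X.+1 - d.+1)%N; have pE : (X.+1 - d)%N = p.+1 by rewrite subnSK.
rewrite pE in ih.
have pX : (p <= X)%N by rewrite /p; lia.
have d0 S c : newton_defect S c 0 = 0 :> F.
  by rewrite /newton_defect big_ord0 mul0r subr0.
have cS j : log_coef_sum X p j = log_coef_sum X p.+1 j + log_coef p j.
  by rewrite /log_coef_sum big_ltn ?ltnS// addrC.
case: (boolP (N %| p)%N) => Np.
- elim: k => [|k ihk]; first exact: d0.
  (* here the series for p + 1 is 1 - a_p t times the series for p *)
  have := @newton_defectS _ (fun k => eps_sum N a X k p.+1)
     (fun k => eps_sum N a X k p)
     (log_coef_sum X p.+1) (log_coef_sum X p) (- a p) k.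
  rewrite !ih ihk mulr0 addr0 => <- //.
  + by rewrite !eps_sum0.
  + by move=> i; rewrite (eps_sumS _ _ _ pX) Np; ring.
  + by move=> j; rewrite cS /log_coef Np opprK; ring.
- case: k => [|k]; first exact: d0.
  rewrite (@newton_defectS _ (fun k => eps_sum N a X k p)
     (fun k => eps_sum N a X k p.+1)
     (log_coef_sum X p) (log_coef_sum X p.+1) (a p) k) ?ih ?mulr0 ?addr0//.
  + by rewrite !eps_sum0.
  + by move=> i; rewrite (eps_sumS _ _ _ pX) (negbTE Np).
  + by move=> j; rewrite cS /log_coef (negbTE Np).
Qed.

End NewtonEpsSum.

Section NewtonBounds.
Variable F : numFieldType.
Implicit Types (S c : nat -> F).

Lemma newtonE S c k : newton_defect S c k.+1 = 0 ->
  S k.+1 = k.+1%:R^-1 * \sum_(j < k.+1) c j.+1 * S (k - j)%N.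
Proof.
move=> /eqP; rewrite /newton_defect subr_eq0 => /eqP E.
by under eq_bigr do rewrite -subSS; rewrite -E mulKf// pnatr_eq0.
Qed.

Lemma newton_bound S c (B : F) : S 0%N = 1 -> 1 <= B ->
  (forall k, newton_defect S c k = 0) -> (forall j, `|c j.+1| <= B) ->
  forall k, `|S k| <= B ^+ k.
Proof.
move=> S0 B1 nd cB k; have B0 : 0 <= B by exact: le_trans ler01 B1.
elim/ltn_ind: k => -[|k] ih; first by rewrite S0 normr1 expr0.
rewrite (newtonE (nd _)) normrM normfV normr_nat ler_pdivrMl ?ltr0n//.
apply: le_trans (ler_norm_sum _ _ _) _.
apply: (@le_trans _ _ (\sum_(j < k.+1) B ^+ k.+1)).
  apply: ler_sum => j _; rewrite normrM exprS ler_pM//.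
  apply: le_trans (ih _ _) _; first by rewrite ltnS leq_subr.
  by rewrite ler_weXn2l// leq_subr.
by rewrite sumr_const card_ord mulr_natl.
Qed.

Lemma newton_cvg (S c : nat -> nat -> F) (d : nat -> F) :
  (forall X, S X 0%N = 1) -> (forall X k, newton_defect (S X) (c X) k = 0) ->
  (forall j, c X j.+1 @[X --> \oo] --> d j) ->
  forall k, cvg (S X k @[X --> \oo]).
Proof.
move=> S0 nd cd k; elim/ltn_ind: k => -[|k] ih.
  by apply/cvg_ex; exists 1; under eq_cvg do rewrite S0; exact: cvg_cst.
apply/cvg_ex;
  exists (k.+1%:R^-1 * \sum_(j < k.+1) d j * lim (S X (k - j)%N @[X --> \oo])).
under eq_cvg do rewrite (newtonE (nd _ _)).
apply: cvgM; first exact: cvg_cst.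
apply: cvg_big => // [|j _].
  exact: add_continuous.
apply: cvgM; first exact: cd.
by apply: ih; rewrite ltnS leq_subr.
Qed.

Variables (N : nat) (a : nat -> F).

(** The contribution of the index i to the generating function. *)
Definition local_factor (t : F) i : F :=
  if (N %| i)%N then (1 - a i * t)^-1 else 1 + a i * t.

(** The generating function of the sums over tuples with entries in [m, X]. *)
Lemma cvg_eps_sum_gen X m (t : F) : (m <= X.+1)%N ->
  (forall i, (m <= i <= X)%N -> 1 - a i * t != 0) ->
  (forall p, (m <= p <= X)%N ->
    eps_sum N a X k p * t ^+ k @[k --> \oo] --> 0) ->
  \sum_(0 <= k < K) eps_sum N a X k m * t ^+ k @[K --> \oo] -->
  \prod_(m <= i < X.+1) local_factor t i.
Proof.
move=> mX; rewrite -(subKn mX).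
elim: (X.+1 - m)%N (leq_subr m X.+1) => [|d ih] dX n0 h0.
  rewrite subn0 big_geq//; apply: cvg_near_cst; near=> K.
  have K0 : (0 < K)%N by near: K; exact: nbhs_infty_gt.
  rewrite -(prednK K0) big_nat_recl// eps_sum0 mul1r expr0 big1 ?addr0// => i _.
  by rewrite eps_sum_gt mul0r.
have {}ih := ih (ltnW dX).
move: n0 h0; set p := (X.+1 - d.+1)%N;
  have pE : (X.+1 - d)%N = p.+1 by rewrite subnSK.
rewrite pE in ih; move=> n0 h0.
have pX : (p <= X)%N by rewrite /p; lia.
have {}ih : \sum_(0 <= k < K) eps_sum N a X k p.+1 * t ^+ k @[K --> \oo] -->
    \prod_(p.+1 <= i < X.+1) local_factor t i.
  by apply: ih => q /andP[pq qX]; [apply: n0|apply: h0]; rewrite (ltnW pq).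
have ihS := ih; rewrite -cvg_shiftS in ihS.
have E K : \sum_(0 <= k < K.+1) eps_sum N a X k p * t ^+ k =
  \sum_(0 <= k < K.+1) eps_sum N a X k p.+1 * t ^+ k +
  a p * t *
    \sum_(0 <= k < K) eps_sum N a X k (if (N %| p)%N then p else p.+1) * t ^+ k.
  rewrite !big_nat_recl// !eps_sum0 -addrA; congr (_ + _).
  rewrite mulr_sumr -big_split/=; apply: eq_bigr => k _.
  by rewrite (eps_sumS _ _ _ pX) exprS; ring.
rewrite (big_ltn (m := p)) ?ltnS//.
suff : (\sum_(0 <= k < K.+1) eps_sum N a X k p * t ^+ k) @[K --> \oo] -->
    local_factor t p * \prod_(p.+1 <= i < X.+1) local_factor t i.
  by move=> h; rewrite -cvg_shiftS; exact: h.
rewrite {1}/local_factor; case: (boolP (N %| p)%N) E => Np E.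
(* if N divides p the partial sums occur on both sides, up to one term *)
- have np := n0 p; rewrite leqnn pX in np; have {}np := np isT.
  have E2 K : \sum_(0 <= k < K.+1) eps_sum N a X k p.+1 * t ^+ k +
     a p * t * \sum_(0 <= k < K) eps_sum N a X k p * t ^+ k =
     (1 - a p * t)^-1 * (\sum_(0 <= k < K.+1) eps_sum N a X k p.+1 * t ^+ k -
       a p * t * (eps_sum N a X K p * t ^+ K)).
    have := E K; rewrite [LHS]big_nat_recr//= => E'.
    apply: (mulfI np); rewrite mulVKf//.
    set u := \sum_(0 <= k < K) _; rewrite -/u in E'.
    set v := \sum_(0 <= k < K.+1) _; rewrite -/v in E'.
    have -> : v = u + eps_sum N a X K p * t ^+ K - a p * t * u.
      by rewrite E'; ring.
    by ring.
  under eq_cvg do rewrite E E2.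
  apply: cvgM; first exact: cvg_cst.
  set L := \prod_(_ <= i < _) _ in ihS *; have -> : L = L - a p * t * 0 by ring.
  apply: cvgB => //.
  apply: cvgM; first exact: cvg_cst.
  by apply: h0; rewrite leqnn.
- under eq_cvg do rewrite E.
  rewrite mulrDl mul1r; apply: cvgD => //.
  by apply: cvgM => //; exact: cvg_cst.
Unshelve. all: by end_near. Qed.

End NewtonBounds.

(** Exchange of limits: U K is the limit in X of the partial sums u X K, whose
    limits f X in K are approached uniformly in X.  It suffices to know the
    limit of f along a subsequence phi. *)
Lemma cvg_exchange (F : numFieldType) (u : nat -> nat -> F) (U f : nat -> F)
    (G : F) (phi : nat -> nat) (e : nat -> F) :
  (forall K, u X K @[X --> \oo] --> U K) ->
  (forall X, u X K @[K --> \oo] --> f X) ->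
  (forall X K L, (K <= L)%N -> `|u X L - u X K| <= e K) ->
  e K @[K --> \oo] --> 0 ->
  phi p @[p --> \oo] --> \oo -> f (phi p) @[p --> \oo] --> G ->
  U K @[K --> \oo] --> G.
Proof.
move=> uU uf ue e0 phioo fG; apply/cvgrPdist_lt => d d0.
have d4 : 0 < d / 4 by rewrite divr_gt0.
have /cvgr0Pnorm_lt/(_ _ d4) ed := e0.
near=> K.
have eK : `|e K| < d / 4 by near: K.
have upK : u (phi p) K @[p --> \oo] --> U K by exact: cvg_comp phioo (uU K).
have /cvgrPdist_lt/(_ _ d4) h1 := upK.
have /cvgrPdist_lt/(_ _ d4) h2 := fG.
near \oo => p.
have hp1 : `|U K - u (phi p) K| < d / 4 by near: p.
have hp2 : `|G - f (phi p)| < d / 4 by near: p.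
have /cvgrPdist_lt/(_ _ d4) h3 := uf (phi p).
near \oo => L.
have hL : `|f (phi p) - u (phi p) L| < d / 4 by near: L.
have KL : (K <= L)%N by near: L; exact: nbhs_infty_ge.
have hKL : `|u (phi p) L - u (phi p) K| < d / 4.
  have eK0 : 0 <= e K by exact: le_trans (normr_ge0 _) (ue _ _ _ KL).
  by apply: le_lt_trans (ue _ _ _ KL) _; rewrite -(ger0_norm eK0).
have -> : d = d / 4 + d / 4 + d / 4 + d / 4 by field.
have -> : G - U K =
    (G - f (phi p)) + (f (phi p) - u (phi p) L) + (u (phi p) L - u (phi p) K) -
    (U K - u (phi p) K).
  by ring.
apply: le_lt_trans (ler_normB _ _) _; rewrite ltrD//.
apply: le_lt_trans (ler_normD _ _) _; rewrite ltrD//.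
by apply: le_lt_trans (ler_normD _ _) _; rewrite ltrD.
Unshelve. all: by end_near. Qed.

(** * Convergence of the logarithmic coefficients *)

Section SeriesInC.
Variable R : realType.
Local Notation C := (cplx R).

Lemma cvg_realC (T : Type) (F : set_system T) {FF : Filter F}
    (v : T -> R) (l : R) :
  v x @[x --> F] --> l -> (v x)%:C%C @[x --> F] --> (l%:C%C : C).
Proof. by move=> h; apply: cvg_complex => //=; exact: cvg_cst. Qed.

Lemma cvg_expr_half : (2^-1 ^+ K : C) @[K --> \oo] --> 0.
Proof.
have -> : (fun K => 2^-1 ^+ K : C) = (fun K => (2^-1 ^+ K : R)%:C%C).
  by apply/funext => K; rewrite rmorphXn fmorphV rmorph_nat.
apply: (@cvg_realC _ _ _ _ 0); apply: cvg_expr.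
by rewrite ger0_norm ?invr_ge0// invf_lt1// ltr1n.
Qed.

Lemma cvg0_normC_le (u v : nat -> C) : (forall K, `|u K| <= v K) ->
  v K @[K --> \oo] --> 0 -> u K @[K --> \oo] --> 0.
Proof.
move=> uv /cvgr0Pnorm_lt v0; apply/cvgr0Pnorm_lt => e e0; near=> K.
apply: le_lt_trans (uv K) _.
have v0' : 0 <= v K by exact: le_trans (normr_ge0 _) (uv K).
by rewrite -(ger0_norm v0'); near: K; exact: v0.
Unshelve. all: by end_near. Qed.

Lemma is_cvg_sum_inv_sqr : cvgn (series (fun i => (i.+1%:R ^+ 2)^-1 : R)).
Proof.
apply: nondecreasing_is_cvgn.
  by apply: nondecreasing_series => i _ _; rewrite invr_ge0 exprn_ge0.
exists 2 => _ [n _ <-]; rewrite /series/= big_mkord; exact: sum_inv_sqr_le2.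
Qed.

Lemma cvg_sum_le_inv_sqr (u : nat -> C) (K : C) :
  (forall i, `|u i| <= K / i.+1%:R ^+ 2) ->
  exists l : C, \sum_(i < X) u i @[X --> \oo] --> l.
Proof.
move=> uK.
have K0 : 0 <= K by have := uK 0%N; rewrite expr1n divr1; exact: le_trans.
have [k KE] : exists k : R, K = k%:C%C.
  exists (complex.Re K); apply: complex_eq => //=.
  by move: K0; rewrite lecE => /andP[/eqP].
have real_part (v : nat -> R) :
    (forall i, `|v i|%:C%C <= `|u i|) -> cvgn (series v).
  move=> vu; apply: normed_cvg.
  apply: (@series_le_cvg R _ (k *: (fun i => (i.+1%:R ^+ 2)^-1 : R)));
    last exact: is_cvg_seriesZ is_cvg_sum_inv_sqr.
  - by move=> n; exact: normr_ge0.
  - move=> n; rewrite /= /GRing.scale/= mulr_ge0 ?invr_ge0 ?exprn_ge0//.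
    by move: K0; rewrite KE lecE/= => /andP[].
  - move=> n; have := le_trans (vu n) (uK n).
    have -> : K / n.+1%:R ^+ 2 = (k / n.+1%:R ^+ 2)%:C%C.
      by rewrite KE rmorphM fmorphV rmorphXn rmorph_nat.
    by rewrite lecE/= => /andP[].
have hr := real_part (fun i => complex.Re (u i)) (fun i => normc_ge_Re (u i)).
have hi : cvgn (series (fun i => complex.Im (u i))).
  apply: real_part => i; have := normc_ge_Re (- 'i%C * u i).
  rewrite normrM normrN (_ : `|'i%C| = 1 :> C); last first.
    by rewrite normc_def /= expr0n expr1n add0r sqrtr1.
  rewrite mul1r; case: (u i) => x y /=.
  by rewrite mulN1r oppr0 mul0r opprK add0r.
exists (limn (series (fun i => complex.Re (u i))) +i*
        limn (series (fun i => complex.Im (u i))))%C.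
have ReS X : complex.Re (\sum_(i < X) u i) =
  series (fun i => complex.Re (u i)) X.
  by rewrite /series/= big_mkord raddf_sum.
have ImS X : complex.Im (\sum_(i < X) u i) =
  series (fun i => complex.Im (u i)) X.
  by rewrite /series/= big_mkord raddf_sum.
apply: cvg_complex => /=.
- by under eq_cvg do rewrite ReS.
- by under eq_cvg do rewrite ImS.
Qed.

Lemma norm_unity_root (z : C) m : (0 < m)%N -> z ^+ m = 1 -> `|z| = 1.
Proof.
move=> m0 z1; have : `|z| ^+ m = 1 by rewrite -normrX z1 normr1.
by move=> /eqP; rewrite pexpr_eq1 ?normr_ge0// => /eqP.
Qed.

(** Summation by parts; A i is the geometric sum z + z^2 + ... + z^i. *)
Lemma sum_geometric_div (z : C) (X : nat) : z != 1 ->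
  let A i := (z - z ^+ i.+1) / (1 - z) in
  \sum_(i < X) z ^+ i.+1 / i.+1%:R =
  A X / X.+1%:R + \sum_(i < X) A i.+1 * (i.+1%:R^-1 - i.+2%:R^-1).
Proof.
move=> z1 A; have nz : 1 - z != 0 by rewrite subr_eq0 eq_sym.
elim: X => [|X ih]; first by rewrite !big_ord0 /A expr1 subrr !mul0r addr0.
rewrite !big_ord_recr/= ih.
have -> : A X.+1 = A X + z ^+ X.+1 by rewrite /A [z ^+ X.+2]exprS; field.
have h1 : X.+1%:R != 0 :> C by rewrite pnatr_eq0.
have h2 : X.+2%:R != 0 :> C by rewrite pnatr_eq0.
by rewrite mulrDl mulrBr mulrDl; ring.
Qed.

(** By summation by parts, since the geometric sums are bounded by
    2 / |1 - z|. *)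
Lemma cvg_sum_unity_div (z : C) m : (0 < m)%N -> z ^+ m = 1 -> z != 1 ->
  (exists l : C, \sum_(i < X) z ^+ i.+1 / i.+1%:R @[X --> \oo] --> l) /\
  exists B : C, forall X, `|\sum_(i < X) z ^+ i.+1 / i.+1%:R| <= B.
Proof.
move=> m0 zm z1; have nz1 := norm_unity_root m0 zm.
pose A i := (z - z ^+ i.+1) / (1 - z).
have nz : 1 - z != 0 by rewrite subr_eq0 eq_sym.
pose K := 2 / `|1 - z|.
have AK i : `|A i| <= K.
  rewrite /A normrM normfV ler_wpM2r ?invr_ge0//.
  by apply: le_trans (ler_normB _ _) _; rewrite normrX nz1 expr1n.
have K0 : 0 <= K by exact: le_trans (normr_ge0 _) (AK 0%N).
have leK i : `|A i.+1 * (i.+1%:R^-1 - i.+2%:R^-1)| <= K / i.+1%:R ^+ 2.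
  rewrite normrM ler_pM//.
  have -> : i.+1%:R^-1 - i.+2%:R^-1 = (i.+1%:R * i.+2%:R)^-1 :> C.
    have h1 : i.+1%:R != 0 :> C by rewrite pnatr_eq0.
    have h2 : i.+1%:R + 1 != 0 :> C by rewrite natr1 pnatr_eq0.
    rewrite -[i.+2%:R]natr1; move: (i.+1%:R : C) h1 h2 => v h1 h2.
    by field; rewrite h1 h2.
  rewrite ger0_norm ?invr_ge0// expr2 lef_pV2 ?posrE ?mulr_gt0//.
  by rewrite ler_pM2l// ler_nat.
have [l cl] := cvg_sum_le_inv_sqr leK.
split.
- exists l; under eq_cvg do rewrite (sum_geometric_div _ z1).
  rewrite -[l]add0r; apply: cvgD; last exact: cl.
  have hv : (K * X.+1%:R^-1) @[X --> \oo] --> (0 : C).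
    rewrite -(mulr0 K); apply: cvgM; first exact: cvg_cst.
    have -> : (fun X => X.+1%:R^-1 : C) = (fun X => (X.+1%:R^-1 : R)%:C%C).
      by apply/funext => X; rewrite fmorphV rmorph_nat.
    by apply: (@cvg_realC _ _ _ _ 0); exact: cvg_harmonic.
  apply: cvg0_normC_le hv => X.
  by rewrite normrM normfV normr_nat; apply: ler_wpM2r;
    [rewrite invr_ge0|exact: AK].
- exists (K + 2 * K) => X; rewrite (sum_geometric_div _ z1).
  apply: le_trans (ler_normD _ _) _; rewrite lerD//.
    rewrite normrM normfV normr_nat -[leRHS]mulr1.
    apply: ler_pM; rewrite ?invr_ge0 ?normr_ge0//; first exact: AK.
    by rewrite invf_le1// ler1n.
  apply: le_trans (ler_norm_sum _ _ _) _.
  apply: (@le_trans _ _ (\sum_(i < X) K / i.+1%:R ^+ 2)).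
    by apply: ler_sum => i _; exact: leK.
  by rewrite -mulr_sumr mulrC ler_wpM2r//; exact: sum_inv_sqr_le2.
Qed.

End SeriesInC.

Section Coefficients.
Variables (R : realType) (N M n : nat) (z : cplx R).
Local Notation C := (cplx R).
Hypotheses (M0 : (0 < M)%N) (n0 : (0 < n)%N).
Hypotheses (zM : z ^+ M = 1) (z1 : n = 1%N -> z != 1).

(** The coefficient attached to the index i in the partial multiple L-values,
    with z a primitive M-th root of unity. *)
Definition dirichlet_coef (i : nat) : C := z ^+ i / i%:R ^+ n.
Local Notation a := dirichlet_coef.

Lemma norm_log_coef i j : `|log_coef N a i.+1 j| = i.+1%:R^-1 ^+ (n * j).
Proof.
have -> : `|log_coef N a i.+1 j| = `|a i.+1 ^+ j|.
  by rewrite /log_coef; case: ifP => // _;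
    rewrite normrN exprNn normrM normrX normrN1 expr1n mul1r.
rewrite normrX normrM normrX (norm_unity_root M0 zM) expr1n mul1r normfV normrX
  normr_nat.
by rewrite -exprVn exprM.
Qed.

Lemma log_coef_sum1E X j :
  log_coef_sum N a X 1 j = \sum_(i < X) log_coef N a i.+1 j.
Proof. by rewrite /log_coef_sum big_add1 big_mkord. Qed.

Lemma norm_log_coef_le i j : (1 < n * j)%N ->
  `|log_coef N a i.+1 j| <= 1 / i.+1%:R ^+ 2.
Proof.
move=> nj; rewrite norm_log_coef div1r -exprVn ler_wiXn2l ?invr_ge0//.
by rewrite invf_le1// ler1n.
Qed.

Lemma cvg_log_coef_sum j :
  exists l : C, log_coef_sum N a X 1 j.+1 @[X --> \oo] --> l.
Proof.
have [nj|nj] := ltnP 1 (n * j.+1).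
  have [l cl] := cvg_sum_le_inv_sqr (fun i => norm_log_coef_le i nj).
  by exists l; under eq_cvg do rewrite log_coef_sum1E.
have [n1 j0] : n = 1%N /\ j = 0%N.
  by move: n0 nj; case: (n) => // -[|k]; case: (j) => //; lia.
have [[l cl] _] := cvg_sum_unity_div M0 zM (z1 n1).
exists l; apply: cvg_trans cl; apply: near_eq_cvg; apply: nearW => X.
rewrite log_coef_sum1E j0; apply: eq_bigr => i _.
by rewrite /log_coef /a n1 !expr1 opprK if_same.
Qed.

Lemma log_coef_sum1_bounded :
  exists B : C, forall X j, `|log_coef_sum N a X 1 j.+1| <= B.
Proof.
(* only for n = 1 is the first coefficient not absolutely summable *)
have [B1 hB1] : exists B : C, forall X,
    (n = 1)%N -> `|log_coef_sum N a X 1 1| <= B.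
  have [n1|n1] := eqVneq n 1%N; last by exists 0 => X /eqP; rewrite (negbTE n1).
  have [_ [B hB]] := cvg_sum_unity_div M0 zM (z1 n1).
  exists B => X _; rewrite log_coef_sum1E; apply: le_trans (hB X).
  rewrite le_eqVlt; apply/orP; left; apply/eqP; congr `|_|;
    apply: eq_bigr => i _.
  by rewrite /log_coef /a n1 !expr1 opprK if_same.
exists (`|B1| + 2) => X j.
have [nj|nj] := ltnP 1 (n * j.+1).
  apply: (@le_trans _ _ 2); last by rewrite lerDr.
  rewrite log_coef_sum1E; apply: le_trans (ler_norm_sum _ _ _) _.
  apply: le_trans (sum_inv_sqr_le2 C X); apply: ler_sum => i _.
  by apply: le_trans (norm_log_coef_le i nj) _; rewrite div1r.
have [n1 j0] : n = 1%N /\ j = 0%N.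
  by move: n0 nj; case: (n) => // -[|k]; case: (j) => //; lia.
rewrite j0; have := hB1 X n1 => h; apply: le_trans h _.
have B10 : 0 <= B1 by exact: le_trans (normr_ge0 _) (hB1 X n1).
by rewrite ger0_norm// lerDl.
Qed.

Lemma log_coef_sum_bounded : exists2 B : C, 1 <= B &
  forall X m j, (0 < m)%N -> `|log_coef_sum N a X m j.+1| <= B.
Proof.
have [B hB] := log_coef_sum1_bounded.
have B0 : 0 <= B by exact: le_trans (normr_ge0 _) (hB 0%N 0%N).
exists (B + B + 1); first by rewrite lerDr addr_ge0.
move=> X m j m0; apply: (@le_trans _ _ (B + B)); last by rewrite lerDl.
have [mX|mX] := leqP m X.+1; last first.
  by rewrite /log_coef_sum big_geq ?normr0 ?addr_ge0// ltnW.
have -> : log_coef_sum N a X m j.+1 =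
  log_coef_sum N a X 1 j.+1 - log_coef_sum N a m.-1 1 j.+1.
  rewrite /log_coef_sum prednK// [X in _ = X - _](@big_cat_nat _ _ _ m)//=;
    ring.
by apply: le_trans (ler_normB _ _) _; rewrite lerD.
Qed.

End Coefficients.

(** * Products over residues and roots of unity *)

Section RootProducts.
Variable F : fieldType.

Lemma prod_blocks B Q (g : nat -> F) :
  \prod_(1 <= i < (B * Q).+1) g i =
    \prod_(q < Q) \prod_(k < B) g (B * q + k.+1)%N.
Proof.
elim: Q => [|Q ih]; first by rewrite muln0 big_geq// big_ord0.
rewrite big_ord_recr /= -ih (@big_cat_nat _ _ _ (B * Q).+1)//=; last first.
  by rewrite ltnS leq_mul2l leqnSn orbT.
congr (_ * _).
rewrite -{1}(add0n (B * Q).+1) big_addn mulnS subSS addnK big_mkord.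
by apply: eq_bigr => i _; rewrite !addnS (addnC i).
Qed.

Lemma prod_multiples N Q (g : nat -> F) : (0 < N)%N ->
  \prod_(1 <= i < (N * Q).+1) (if (N %| i)%N then g i else 1) =
  \prod_(1 <= l < Q.+1) g (N * l)%N.
Proof.
case: N => // N _; rewrite prod_blocks [RHS]big_add1 big_mkord.
apply: eq_bigr => q _.
rewrite big_ord_recr/= big1 ?mul1r.
  by rewrite -mulnSr dvdn_mulr.
move=> k _; rewrite dvdn_addr ?dvdn_mulr//; case: ifP => // h.
by have := dvdn_leq (ltn0Sn k) h; rewrite ltnS leqNgt ltn_ord.
Qed.

Lemma prod_primitive_root m (xi y : F) : m.-primitive_root xi ->
  \prod_(j < m) (1 - xi ^+ j * y) = 1 - y ^+ m.
Proof.
move=> xim; have m0 := prim_order_gt0 xim.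
have [->|y0] := eqVneq y 0.
  by rewrite expr0n gtn_eqF// subr0 big1// => j _; rewrite mulr0 subr0.
have := congr1 (fun p => p.[y^-1]) (factor_Xn_sub_1 xim).
rewrite /= horner_prod hornerD hornerN hornerC hornerXn big_mkord => h.
transitivity (\prod_(j < m) (y * ('X - (xi ^+ j)%:P).[y^-1])).
  by apply: eq_bigr => j _; rewrite hornerXsubC mulrBr divff// mulrC.
by rewrite big_split/= h prodr_const card_ord mulrBr mulr1 -exprMn divff//
  expr1n.
Qed.

Lemma prim_root_half n (xi : F) : (2 * n).-primitive_root xi -> xi ^+ n = -1.
Proof.
move=> xip; have n0 : (0 < n)%N by have := prim_order_gt0 xip; rewrite muln_gt0.
have /eqP := prim_expr_order xip.
rewrite mulnC exprM -subr_eq0 subr_sqr_1 mulf_eq0 subr_eq0 addr_eq0.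
case/orP => /eqP // h; have := prim_order_dvd xip n.
by rewrite h eqxx => /idP /(dvdn_leq n0); lia.
Qed.

(** The odd powers of a primitive 2n-th root of unity are the n-th roots
    of -1. *)
Lemma prod_odd_root n (xi y : F) : (2 * n).-primitive_root xi ->
  \prod_(j < n) (1 - xi ^ (2 * j%:Z - 1) * y) = 1 + y ^+ n.
Proof.
move=> xip; have xi0 : xi != 0.
  apply: contraTneq (oner_neq0 F) => xi0.
  rewrite -(prim_expr_order xip) xi0 expr0n.
  by rewrite gtn_eqF ?(prim_order_gt0 xip)// eqxx.
have p2 : n.-primitive_root (xi ^+ 2).
  by have := exp_prim_root xip 2; rewrite gcdnMr mulKn.
transitivity (\prod_(j < n) (1 - (xi ^+ 2) ^+ j * (xi^-1 * y))).
  apply: eq_bigr => j _; congr (1 - _); rewrite mulrA; congr (_ * _).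
  by rewrite expfzDr// -exprM.
rewrite (prod_primitive_root _ p2) exprMn exprVn (prim_root_half xip).
by rewrite invrN1 mulN1r opprK.
Qed.

Lemma sum_root_eq0 m (xi : F) : xi ^+ m = 1 -> xi != 1 ->
  \sum_(j < m) xi ^+ j = 0.
Proof.
move=> xim xi1; have := subrX1 xi m; rewrite xim subrr => /esym/eqP.
by rewrite mulf_eq0 subr_eq0 (negbTE xi1) => /eqP.
Qed.

End RootProducts.

(** * The generating function as a quotient of Gamma products *)

Section Assembly.
Variables (R : realType) (w : nat -> cplx R) (n N M : nat).
Local Notation C := (cplx R).
Hypothesis hw : compatible_roots w.
Hypotheses (n0 : (0 < n)%N) (N0 : (0 < N)%N) (M0 : (0 < M)%N).
Hypothesis nM : (n, M) <> (1%N, 1%N).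

Local Notation a := (dirichlet_coef n (w M)).

Lemma partialS_eps_sum k X : partialS w N M n k X = eps_sum N a X k 1.
Proof.
apply: eq_bigr => t _; rewrite /eps_weight /dirichlet_coef; congr (_ * _).
by rewrite prodf_div prodrXr prodrXl.
Qed.

Let prim m : (0 < m)%N -> m.-primitive_root (w m).
Proof. exact: (proj1 hw). Qed.

Lemma root_expM : w (M * n)%N ^+ n = w M. Proof. exact: (proj2 hw). Qed.

Lemma norm_w m : (0 < m)%N -> `|w m| = 1.
Proof.
by move=> m0; apply: (norm_unity_root m0); exact: prim_expr_order (prim m0).
Qed.

Lemma w_neq0 m : (0 < m)%N -> w m != 0.
Proof. by move=> m0; rewrite -normr_eq0 norm_w// oner_neq0. Qed.

Lemma w_neq1 m : (1 < m)%N -> w m != 1.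
Proof.
move=> m1; have := prim_order_dvd (prim (ltnW m1)) 1.
by rewrite expr1 => /esym h; apply/eqP => /eqP; rewrite h dvdn1 gtn_eqF.
Qed.

(** The arguments of Gamma in the statement: [num_arg] comes from the numerator
    of the finite product F_X and ends up in the denominator of the result,
    [den_arg] the other way round; [base_arg] is their common value at
    x = 0. *)
Definition num_arg (x : C) k j : C :=
  M%:R^-1 * (k%:R - w (2 * n)%N ^ (2 * j%:Z - 1) * w (M * n)%N ^+ k * x).
Definition den_arg (x : C) k j : C :=
  M%:R^-1 * (k%:R - N%:R^-1 * w (2 * n)%N ^+ j * w (M * n)%N ^+ (k * N) * x).
Definition base_arg k : C := k%:R / M%:R.

Let MC : (M%:R : C) != 0. Proof. by rewrite pnatr_eq0 -lt0n. Qed.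
Let NC : (N%:R : C) != 0. Proof. by rewrite pnatr_eq0 -lt0n. Qed.

Lemma w_block r k : w M ^+ (M * r + k) = w M ^+ k.
Proof. by rewrite exprD exprM (prim_expr_order (prim M0)) expr1n mul1r. Qed.

Lemma num_factor (x : C) r k :
  1 + a (M * r + k.+1) * x ^+ n =
  \prod_(j < n) ((num_arg x k.+1 j + r%:R) / (base_arg k.+1 + r%:R)).
Proof.
have d0 : ((M * r + k.+1)%N%:R : C) != 0 by rewrite pnatr_eq0 addnS.
rewrite /dirichlet_coef w_block -root_expM exprAC.
rewrite -expr_div_n -exprMn -(prod_odd_root _ (prim _)) ?muln_gt0//.
apply: eq_bigr => j _; rewrite /num_arg /base_arg.
move: d0; rewrite natrD natrM => d0; field.
by rewrite MC /= nat1r addrC mulrC.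
Qed.

Lemma den_factor (x : C) r k :
  1 - (a (N * (M * r + k.+1)) * x ^+ n) ^+ 2 =
  \prod_(j < 2 * n) ((den_arg x k.+1 j + r%:R) / (base_arg k.+1 + r%:R)).
Proof.
have d0 : ((M * r + k.+1)%N%:R : C) != 0 by rewrite pnatr_eq0 addnS.
rewrite /dirichlet_coef [w M ^+ _](_ : _ = (w (M * n)%N ^+ (k.+1 * N)) ^+ n);
  last first.
  by rewrite mulnC exprM w_block -exprM -root_expM exprAC.
rewrite -expr_div_n -exprMn -exprM (mulnC n) -(prod_primitive_root _ (prim _))
  ?muln_gt0//.
apply: eq_bigr => j _; rewrite /den_arg /base_arg.
move: d0; rewrite natrM natrD natrM => d0; field.
by rewrite MC NC /= nat1r addrC mulrC d0.
Qed.

Lemma Re_arg (v : C) k : `|v| < 1 -> (k < M)%N ->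
  0 < complex.Re (M%:R^-1 * (k.+1%:R - v)) < 2.
Proof.
move=> v1 kM.
have : `|complex.Re v| < 1.
  by have := le_lt_trans (normc_ge_Re v) v1; rewrite ltcE/= => /andP[].
rewrite ltr_norml => /andP[v1l v1r].
have -> : complex.Re (M%:R^-1 * (k.+1%:R - v)) =
  (k.+1%:R - complex.Re v) / M%:R.
  have -> : M%:R^-1 = (M%:R^-1)%:C%C :> C by rewrite fmorphV rmorph_nat.
  rewrite Re_realM mulrC; congr (_ / _).
  have -> : k.+1%:R = (k.+1%:R)%:C%C :> C by rewrite rmorph_nat.
  by case: (v).
have MR : 0 < M%:R :> R by rewrite ltr0n.
have kM' : k.+1%:R <= M%:R :> R by rewrite ler_nat.
have M1 : 1 <= M%:R :> R by rewrite ler1n.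
have k1 : 1 <= k.+1%:R :> R by rewrite ler1n.
rewrite divr_gt0//= ?ltr_pdivrMr//; lra.
Qed.

Lemma norm_exprz1 (u : C) (m : int) : `|u| = 1 -> `|u ^ m| = 1.
Proof.
by move=> u1; case: m => m; rewrite /exprz ?normfV normrX u1 expr1n ?invr1.
Qed.

Lemma Re_num_arg (x : C) k j : `|x| < 1 -> (k < M)%N ->
  0 < complex.Re (num_arg x k.+1 j) < 2.
Proof.
move=> x1 kM; apply: Re_arg => //.
by rewrite !normrM norm_exprz1 ?norm_w ?muln_gt0// normrX norm_w ?muln_gt0
  ?M0// expr1n !mul1r.
Qed.

Lemma Re_den_arg (x : C) k j : `|x| < 1 -> (k < M)%N ->
  0 < complex.Re (den_arg x k.+1 j) < 2.
Proof.
move=> x1 kM; apply: Re_arg => //.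
rewrite !normrM !normrX !norm_w ?muln_gt0 ?M0// !expr1n !mulr1 normfV normr_nat.
by apply: le_lt_trans x1; rewrite ler_piMl// invf_le1 ?ltr0n// ler1n.
Qed.

Lemma Re_base_arg k : (k < M)%N -> 0 < complex.Re (base_arg k.+1) < 2.
Proof.
move=> kM; have := @Re_arg 0 k; rewrite normr0 ltr01 subr0 mulrC; exact.
Qed.

(** The roots of unity that distinguish the two sides sum to 0: over j when
    n > 1, and over k when n = 1, in which case M > 1. *)
Lemma sum_num_arg (x : C) :
  \sum_(i : 'I_M * 'I_n) num_arg x i.1.+1 i.2 =
    \sum_(i : 'I_M * 'I_n) base_arg i.1.+1.
Proof.
pose A k j : C := w (2 * n)%N ^ (2 * j%:Z - 1) * w (M * n)%N ^+ k.
have E k j : num_arg x k j = base_arg k - M%:R^-1 * x * A k j.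
  by rewrite /num_arg /base_arg /A; ring.
under eq_bigr do rewrite E.
rewrite sumrB -mulr_sumr.
suff -> : \sum_(i : 'I_M * 'I_n) A i.1.+1 i.2 = 0 by rewrite mulr0 subr0.
rewrite -(pair_bigA _ (fun (k : 'I_M) (j : 'I_n) => A k.+1 j))/=.
under eq_bigr do rewrite -mulr_suml.
rewrite -mulr_sumr.
have n20 : (0 < 2 * n)%N by rewrite muln_gt0.
have [n1|n1] := ltnP 1 n.
  suff -> : \sum_(j < n) w (2 * n)%N ^ (2 * j%:Z - 1) = 0 by rewrite mul0r.
  under eq_bigr => j _ do
    rewrite expfzDr ?w_neq0// -[_ ^ (2 * _)]/(_ ^+ (2 * j)) exprM.
  have s0 : \sum_(j < n) (w (2 * n)%N ^+ 2) ^+ j = 0.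
    apply: sum_root_eq0; first by rewrite -exprM (prim_expr_order (prim n20)).
    by rewrite -(prim_order_dvd (prim n20));
      apply/negP => /(dvdn_leq (ltn0Sn 1)); lia.
  by rewrite -mulr_suml s0 mul0r.
have n1' : n = 1%N by lia.
have M1 : (1 < M)%N by move: nM M0; rewrite n1'; case: (M) => [|[|m]].
under [X in _ * X]eq_bigr do rewrite exprS.
have s0 : \sum_(k < M) w M ^+ k = 0.
  by apply: sum_root_eq0; [exact: prim_expr_order (prim M0)|exact: w_neq1].
by rewrite -mulr_sumr n1' !muln1 s0 !mulr0.
Qed.

Lemma sum_den_arg (x : C) :
  \sum_(i : 'I_M * 'I_(2 * n)) den_arg x i.1.+1 i.2 =
    \sum_(i : 'I_M * 'I_(2 * n)) base_arg i.1.+1.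
Proof.
pose A k j : C := w (2 * n)%N ^+ j * w (M * n)%N ^+ (k * N).
have E k j : den_arg x k j = base_arg k - M%:R^-1 * N%:R^-1 * x * A k j.
  by rewrite /den_arg /base_arg /A; ring.
under eq_bigr do rewrite E.
rewrite sumrB -mulr_sumr.
suff -> : \sum_(i : 'I_M * 'I_(2 * n)) A i.1.+1 i.2 = 0.
  by rewrite mulr0 subr0.
rewrite -(pair_bigA _ (fun (k : 'I_M) (j : 'I_(2 * n)) => A k.+1 j))/=.
under eq_bigr do rewrite -mulr_suml.
rewrite -mulr_sumr sum_root_eq0 ?mul0r//.
  by rewrite prim_expr_order//; apply: prim; rewrite muln_gt0.
by apply: w_neq1; lia.
Qed.

Lemma cvg_num_prod (x : C) : `|x| < 1 ->
  \prod_(1 <= i < (M * p.+1).+1) (1 + a i * x ^+ n) @[p --> \oo] -->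
  \prod_(k < M) \prod_(j < n)
    (Gamma (base_arg k.+1) / Gamma (num_arg x k.+1 j)).
Proof.
move=> x1.
have := @cvg_gamma_prod R ('I_M * 'I_n)%type
  (fun i => num_arg x i.1.+1 i.2) (fun i => base_arg i.1.+1).
move=> /(_ _ _ (sum_num_arg x)) h.
rewrite (pair_bigA _ (fun (k : 'I_M) (j : 'I_n) =>
  Gamma (base_arg k.+1) / Gamma (num_arg x k.+1 j)))/=.
have {}h := h (fun i => Re_num_arg _ x1 (ltn_ord i.1))
  (fun i => proj1 (andP (Re_base_arg (ltn_ord i.1)))).
apply: cvg_trans h; apply: near_eq_cvg; apply: nearW => p.
rewrite prod_blocks -(pair_bigA _ (fun (k : 'I_M) (j : 'I_n) =>
  \prod_(q < p.+1) ((num_arg x k.+1 j + q%:R) / (base_arg k.+1 + q%:R))))/=.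
rewrite [RHS]exchange_big/=; apply: eq_bigr => k _.
rewrite exchange_big/=; apply: eq_bigr => r _; exact/esym/num_factor.
Qed.

Lemma cvg_den_prod (x : C) : `|x| < 1 ->
  \prod_(1 <= l < (M * p.+1).+1) (1 - (a (N * l) * x ^+ n) ^+ 2)
    @[p --> \oo] -->
  \prod_(k < M) \prod_(j < 2 * n)
    (Gamma (base_arg k.+1) / Gamma (den_arg x k.+1 j)).
Proof.
move=> x1.
have := @cvg_gamma_prod R ('I_M * 'I_(2 * n))%type
  (fun i => den_arg x i.1.+1 i.2) (fun i => base_arg i.1.+1).
move=> /(_ _ _ (sum_den_arg x)) h.
rewrite (pair_bigA _ (fun (k : 'I_M) (j : 'I_(2 * n)) =>
  Gamma (base_arg k.+1) / Gamma (den_arg x k.+1 j)))/=.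
have {}h := h (fun i => Re_den_arg _ x1 (ltn_ord i.1))
  (fun i => proj1 (andP (Re_base_arg (ltn_ord i.1)))).
apply: cvg_trans h; apply: near_eq_cvg; apply: nearW => p.
rewrite prod_blocks -(pair_bigA _ (fun (k : 'I_M) (j : 'I_(2 * n)) =>
  \prod_(q < p.+1) ((den_arg x k.+1 j + q%:R) / (base_arg k.+1 + q%:R))))/=.
rewrite [RHS]exchange_big/=; apply: eq_bigr => k _.
rewrite exchange_big/=; apply: eq_bigr => r _; exact/esym/den_factor.
Qed.

Lemma gammaRHSE (x : C) : `|x| < 1 -> gammaRHS w N M n x =
  (\prod_(k < M) \prod_(j < n)
     (Gamma (base_arg k.+1) / Gamma (num_arg x k.+1 j))) /
  (\prod_(k < M) \prod_(j < 2 * n)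
     (Gamma (base_arg k.+1) / Gamma (den_arg x k.+1 j))).
Proof.
move=> x1; rewrite /gammaRHS.
(* abstracting Gamma keeps its definition, itself a quotient, folded *)
move: (@Gamma R) (@Gamma_neq0 R) => Gm Gm0.
rewrite big_add1 big_mkord -prodf_div; apply: eq_bigr => k _.
rewrite !big_mkord !prodf_div !prodr_const !card_ord.
have G0 : Gm (base_arg k.+1) != 0 by apply: Gm0; exact: Re_base_arg.
have P1 : \prod_(j < n) Gm (num_arg x k.+1 j) != 0.
  by apply/prodf_neq0 => j _; apply: Gm0; exact: Re_num_arg.
have P2 : \prod_(j < 2 * n) Gm (den_arg x k.+1 j) != 0.
  by apply/prodf_neq0 => j _; apply: Gm0; exact: Re_den_arg.
change ((\prod_(j < 2 * n) Gm (den_arg x k.+1 j)) /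
  (Gm (base_arg k.+1) ^+ n * \prod_(j < n) Gm (num_arg x k.+1 j)) =
  (Gm (base_arg k.+1) ^+ n / \prod_(j < n) Gm (num_arg x k.+1 j)) /
  (Gm (base_arg k.+1) ^+ (2 * n) / \prod_(j < 2 * n) Gm (den_arg x k.+1 j))).
move: (Gm (base_arg k.+1)) (\prod_(j < n) _) (\prod_(j < 2 * n) _) G0 P1 P2 =>
  G A B G0 A0 B0.
have -> : G ^+ (2 * n) = G ^+ n * G ^+ n by rewrite mul2n -addnn exprD.
have Gn := expf_neq0 n G0; field.
by rewrite A0 B0 Gn.
Qed.

Lemma den_prod_neq0 (x : C) : `|x| < 1 ->
  \prod_(k < M) \prod_(j < 2 * n)
    (Gamma (base_arg k.+1) / Gamma (den_arg x k.+1 j)) != 0.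
Proof.
move=> x1; apply/prodf_neq0 => k _; apply/prodf_neq0 => j _.
by apply: mulf_neq0; rewrite ?invr_eq0; apply: Gamma_neq0;
  [exact: Re_base_arg|exact: Re_den_arg].
Qed.

Lemma norm_dirichlet_coef_lt1 (x : C) i : `|x| < 1 -> (0 < i)%N ->
  `|a i * x ^+ n| < 1.
Proof.
move=> x1 i0; rewrite normrM !normrM !normrX norm_w// expr1n mul1r.
rewrite normfV normrX normr_nat.
apply: (@le_lt_trans _ _ (`|x| ^+ n)); last by rewrite exprn_ilt1// -lt0n.
rewrite ler_piMl ?exprn_ge0// invf_le1 ?exprn_gt0 ?ltr0n//.
by rewrite exprn_ege1// ler1n.
Qed.

Lemma add1_neq0 (u : C) : `|u| < 1 -> 1 + u != 0.
Proof.
by move=> u1; apply: contraTneq u1 => /eqP; rewrite addr_eq0 => /eqP h;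
  rewrite -normrN -h normr1 ltxx.
Qed.

(** If N divides i, then 1/(1 - u) = (1 + u) / (1 - u^2) with u = a_i x^n. *)
Lemma prod_local_factor (x : C) p : `|x| < 1 ->
  \prod_(1 <= i < (M * (N * p.+1)).+1) local_factor N a (x ^+ n) i =
  (\prod_(1 <= i < (M * (N * p.+1)).+1) (1 + a i * x ^+ n)) /
  (\prod_(1 <= l < (M * p.+1).+1) (1 - (a (N * l) * x ^+ n) ^+ 2)).
Proof.
move=> x1.
rewrite -(prod_multiples (M * p.+1) (fun i => 1 - (a i * x ^+ n) ^+ 2) N0).
rewrite mulnCA -prodf_div; apply: eq_big_nat => i /andP[i0 _].
have au := norm_dirichlet_coef_lt1 x1 i0.
rewrite /local_factor; case: ifP => _; last by rewrite divr1.
have h1 := add1_neq0 au.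
have h2 : 1 - a i * x ^+ n != 0 by apply: add1_neq0; rewrite normrN.
rewrite -[1 - _ ^+ 2](_ : (1 - a i * x ^+ n) * (1 + a i * x ^+ n) = _);
  last by ring.
by rewrite invfM mulrCA divff// mulr1.
Qed.

Lemma cvg_local_factor (x : C) : `|x| < 1 ->
  \prod_(1 <= i < (M * (N * p.+1)).+1) local_factor N a (x ^+ n) i
    @[p --> \oo] --> gammaRHS w N M n x.
Proof.
move=> x1; rewrite gammaRHSE//; under eq_cvg do rewrite prod_local_factor//.
apply: cvgM; last by apply: cvgV; [exact: den_prod_neq0|exact: cvg_den_prod].
(* the numerator has N (p + 1) factors in each residue class *)
have phi : (N * p.+1).-1 @[p --> \oo] --> \oo.
  apply/cvgnyPge => A; near=> p.
  have : (A <= p)%N by near: p; exact: nbhs_infty_ge.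
  by move: N0; case: (N) => // N'; rewrite mulSn addSn /=; lia.
have h := cvg_comp _ _ phi (cvg_num_prod x1).
apply: cvg_trans h; apply: near_eq_cvg; apply: nearW => p /=.
by rewrite prednK// muln_gt0 N0.
Unshelve. all: by end_near. Qed.

Lemma eps_sum_bound : exists2 B : R, 1 <= B &
  forall X k m, (0 < m <= X.+1)%N -> `|eps_sum N a X k m| <= (B%:C%C : C) ^+ k.
Proof.
have z1 : n = 1%N -> w M != 1.
  by move=> n1; apply: w_neq1; move: nM M0; rewrite n1; case: (M) => [|[|m]].
have [B B1 hB] := log_coef_sum_bounded N M0 n0 (prim_expr_order (prim M0)) z1.
have BE : B = (complex.Re B)%:C%C.
  apply: complex_eq => //=; have := le_trans ler01 B1.
  by rewrite lecE => /andP[/eqP].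
exists (complex.Re B); first by move: B1; rewrite lecE => /andP[].
move=> X k m /andP[m0 mX]; rewrite -BE.
apply: (@newton_bound C (fun k => eps_sum N a X k m) (log_coef_sum N a X m)) =>
  //.
- exact: eps_sum0.
- by move=> i; exact: newton_eps_sum.
- by move=> j; exact: hB.
Qed.

Lemma cvg_partialS k : cvg (partialS w N M n k X @[X --> \oo]).
Proof.
have z1 : n = 1%N -> w M != 1.
  by move=> n1; apply: w_neq1; move: nM M0; rewrite n1; case: (M) => [|[|m]].
have cl j := cvg_log_coef_sum N M0 n0 (prim_expr_order (prim M0)) z1 j.
have [d hd] := choice cl.
have E0 X : eps_sum N a X 0 1 = 1 by exact: eps_sum0.
have Enewton X i : newton_defect (fun k => eps_sum N a X k 1)
    (log_coef_sum N a X 1) i = 0 by exact: newton_eps_sum.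
have /cvg_ex[l hl] : cvg (eps_sum N a X k 1 @[X --> \oo]).
  exact: newton_cvg E0 Enewton hd _.
apply/cvg_ex; exists l; under eq_cvg do rewrite partialS_eps_sum.
exact: hl.
Qed.

(** The case distinction on k matches the convention S_0 = 1. *)
Lemma cvg_multipleS k : eps_sum N a X k 1 @[X --> \oo] --> multipleS w N M n k.
Proof.
case: k => [|k]; first by under eq_cvg do rewrite eps_sum0; exact: cvg_cst.
rewrite /multipleS.
have h : cvg (partialS w N M n k.+1 X @[X --> \oo]) by exact: cvg_partialS.
by under eq_cvg do rewrite -partialS_eps_sum; exact: h.
Qed.

Lemma sum_half_le (F : numFieldType) K L : (K <= L)%N ->
  \sum_(K <= k < L) 2^-1 ^+ k <= 2 * 2^-1 ^+ K :> F.
Proof.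
move=> KL.
suff -> : \sum_(K <= k < L) 2^-1 ^+ k = 2 * 2^-1 ^+ K - 2 * 2^-1 ^+ L :> F.
  by rewrite gerBl mulr_ge0 ?exprn_ge0 ?invr_ge0.
rewrite -(subnK KL); elim: (L - K)%N => [|d ih].
  by rewrite add0n big_geq// subrr.
by rewrite addSn big_nat_recr ?leq_addl//= ih exprS; field.
Qed.

Lemma generating_function : exists r : R, 0 < r /\
  forall x : C, `|x| < r%:C%C ->
    (\sum_(0 <= k < K) multipleS w N M n k * x ^+ (n * k)) @[K --> \oo]
      --> gammaRHS w N M n x.
Proof.
have [B B1 hB] := eps_sum_bound.
have B0 : 0 < B by exact: lt_le_trans B1.
(* then B |x^n| <= 1/2, which makes the tails geometric of ratio 1/2 *)
exists (2 * B)^-1; split; first by rewrite invr_gt0 mulr_gt0.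
move=> x xr.
have r1 : (2 * B)^-1 <= 1.
  by rewrite invf_le1 ?mulr_gt0//; lra.
have x1 : `|x| < 1.
  by apply: lt_le_trans xr _; rewrite lecE /= eqxx.
pose t := x ^+ n.
have tB : B%:C%C * `|t| <= 2^-1.
  have tx : `|t| <= (2 * B)^-1%:C%C.
    apply: le_trans (ltW xr); rewrite /t normrX -[leRHS]expr1.
    by apply: ler_wiXn2l => //; exact: ltW.
  apply: (@le_trans _ _ (B%:C%C * (2 * B)^-1%:C%C)).
    by rewrite ler_wpM2l// lecE /= eqxx ltW.
  rewrite -rmorphM invfM mulrCA divff ?gt_eqF// mulr1 fmorphV rmorph_nat//.
have term X k m : (0 < m <= X.+1)%N ->
    `|eps_sum N a X k m * t ^+ k| <= 2^-1 ^+ k.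
  move=> hm; rewrite normrM normrX.
  apply: (@le_trans _ _ ((B%:C%C * `|t|) ^+ k)).
    by rewrite exprMn ler_wpM2r ?exprn_ge0//; exact: hB.
  by apply: lerXn2r; rewrite ?nnegrE ?invr_ge0 ?mulr_ge0// lecE /= eqxx ltW.
pose u X K := \sum_(0 <= k < K) eps_sum N a X k 1 * t ^+ k.
apply: (@cvg_exchange C u _
  (fun X => \prod_(1 <= i < X.+1) local_factor N a t i)
  _ (fun p => (M * (N * p.+1))%N) (fun K => 2 * 2^-1 ^+ K)).
- move=> K; rewrite /u.
  apply: cvg_big => [|k _]; first exact: add_continuous.
  rewrite exprM; apply: cvgM; [exact: cvg_multipleS|exact: cvg_cst].
- move=> X; apply: cvg_eps_sum_gen => //.
  + move=> i /andP[i0 iX]; apply: add1_neq0; rewrite normrN.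
    exact: norm_dirichlet_coef_lt1.
  + move=> p /andP[p0 pX]; apply: cvg0_normC_le (@cvg_expr_half R) => k.
    by apply: term; rewrite p0 ltnW.
- move=> X K L KL.
  have -> : u X L - u X K = \sum_(K <= k < L) eps_sum N a X k 1 * t ^+ k.
    by apply/eqP; rewrite subr_eq addrC -big_cat_nat.
  apply: le_trans (ler_norm_sum _ _ _) _.
  apply: (@le_trans _ _ (\sum_(K <= k < L) 2^-1 ^+ k)).
    by apply: ler_sum => k _; apply: term.
  exact: sum_half_le.
- rewrite -(mulr0 2); apply: cvgM; [exact: cvg_cst|exact: cvg_expr_half].
- apply/cvgnyPge => A; near=> p.
  have : (A <= p)%N by near: p; exact: nbhs_infty_ge.
  by move: M0 N0; case: (M) => // M' _; case: (N) => // N' _; rewrite !mulSn; lia.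
- exact: cvg_local_factor.
Unshelve. all: by end_near. Qed.

End Assembly.

Theorem theorem2p7 (R : realType) (w : nat -> cplx R) (n N M : nat) :
  compatible_roots w ->
  (0 < n)%N -> (0 < N)%N -> (0 < M)%N -> (n, M) <> (1%N, 1%N) ->
  (forall k : nat, cvg (partialS w N M n k X @[X --> \oo])) /\
  exists r : R, 0 < r /\
    forall x : cplx R, `|x| < r%:C%C ->
      (\sum_(0 <= k < K) multipleS w N M n k * x ^+ (n * k)) @[K --> \oo]
        --> gammaRHS w N M n x.
Proof.
move=> hw n0 N0 M0 nM; split; last exact: generating_function.
by move=> k; exact: cvg_partialS.
Qed.
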